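(* Let $G$ be a finite graph and let $\mathcal L$ be a non-trivial linear class of bonds of $G$. Then there is a matroid on the element set $E(G)\cup\{e_0\}$ (with $e_0\notin E(G)$), in which $e_0$ is neither a loop nor a coloop, whose cocircuits are exactly the following sets: (1) the bonds of $G$ that belong to $\mathcal L$; (2) the sets $B\cup\{e_0\}$ where $B$ is a bond of $G$ not in $\mathcal L$; (3) the tribonds and dibonds of $G$ that do not contain (as a subset) any bond belonging to $\mathcal L$. Conversely, if $N$ is a single-element extension of the graphic (cycle) matroid $M(G)$ by a new element $e_0$ that is neither a loop nor a coloop of $N$, then there is a non-trivial linear class of bonds $\mathcal L$ of $G$ such that the cocircuits of $N$ are exactly the sets described in (1)–(3).
   Context: Graphs are finite and may have loops and multiple edges; a link is a non-loop edge. For $X\subseteq V(G)$, $\delta(X)$ denotes the set of links with exactly one endpoint in $X$. A bond is a minimal nonempty edge cut; equivalently a set $\delta(X)$ where $X$ is a nonempty proper subset of the vertex set $V(C)$ of a connected component $C$ of $G$ with $G[X]$ and $G[V(C)\setminus X]$ both connected and $\delta(X)\neq\emptyset$. A tribond is a set $\delta(X_1)\cup\delta(X_2)\cup\delta(X_3)$ where $\{X_1,X_2,X_3\}$ is a partition of the vertex set of one connected component of $G$ into nonempty sets such that each induced subgraph $G[X_i]$ is connected and there is at least one edge joining each pair $X_i,X_j$ ($i\ne j$); its three bonds are $\delta(X_1),\delta(X_2),\delta(X_3)$. A linear class of bonds is a set $\mathcal L$ of bonds of $G$ such that for every such tripartition, the number of $i$ with $\delta(X_i)\in\mathcal L$ is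 not exactly two. $\mathcal L$ is trivial if it consists of all bonds of $G$. Two bonds $B_1,B_2$ form a modular pair if $G-(B_1\cup B_2)$ has exactly two more connected components than $G$. A dibond is a union $B_1\cup B_2$ of a modular pair of bonds that is not a tribond (equivalently: either $B_1=\delta(X_1)$, $B_2=\delta(X_2)$ for a partition $\{X_1,X_2,X_3\}$ of the vertex set of a component into nonempty sets each inducing a connected subgraph, with edges between $X_1,X_3$ and between $X_2,X_3$ but none between $X_1,X_2$; or $B_1,B_2$ lie in two different connected components of $G$). *)

(* Defs.v *)
From mathcomp Require Import all_boot.

Set Implicit Arguments.
Unset Strict Implicit.
Unset Printing Implicit Defensive.

(* A matroid on the whole of a finite type T is given by its collection
   I : {set {set T}} of independent sets; is_matroid I states the axioms. *)
Section Matroid.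

Variable T : finType.
Implicit Types (I : {set {set T}}) (A B C X : {set T}) (x : T).

Definition is_matroid I : Prop :=
  [/\ set0 \in I,
      forall A B, A \subset B -> B \in I -> A \in I
    & forall A B, A \in I -> B \in I -> #|A| < #|B| ->
        exists2 x, x \in B :\: A & x |: A \in I].

Definition bases I : {set {set T}} := [set B | maxset [pred A : {set T} | A \in I] B].

Definition circuits I : {set {set T}} :=
  [set C | minset [pred A : {set T} | A \notin I] C].

(* The bases of the dual are the complements of the bases. *)
Definition dual I : {set {set T}} :=
  [set X : {set T} | [exists B in bases I, X \subset ~: B]].

Definition cocircuits I : {set {set T}} := circuits (dual I).

Definition loop I x : bool := [set x] \in circuits I.

Definition coloop I x : bool := loop (dual I) x.

End Matroid.

(* A single-element extension of a matroid on T lives on option T, the new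
   element e0 being None; deleting e0 must give back the matroid I. *)
Definition single_element_extension (T : finType)
    (I : {set {set T}}) (N : {set {set option T}}) : Prop :=
  is_matroid N /\ [set X : {set T} | Some @: X \in N] = I.

(* The set ends e has one element when e is a loop, two when e is a link. *)
Record multigraph := Multigraph {
  vertex : finType;
  edge : finType;
  ends : edge -> {set vertex};
  card_ends : forall e, 0 < #|ends e| <= 2
}.

Section Multigraph.

Variable G : multigraph.
Implicit Types (X Y C : {set vertex G}) (B F : {set edge G}).

Definition link (e : edge G) : bool := #|ends e| == 2.

Definition cut X : {set edge G} := [set e | link e & #|ends e :&: X| == 1].

(* Adjacency in the spanning subgraph with edge set F. *)
Definition adj F : rel (vertex G) :=
  fun x y => [exists e in F, ends e == [set x; y]].

Definition n_components F : nat := n_comp (adj F) predT.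

Definition component C : bool :=
  [exists x, C == [set y | connect (adj setT) x y]].

Definition induced_connected X : bool :=
  (X != set0) &&
  [forall x in X, forall y in X, connect (adj [set e | ends e \subset X]) x y].

Definition joined X Y : bool :=
  [exists x in X, exists y in Y, adj setT x y].

Definition bonds : {set {set edge G}} :=
  [set B | minset [pred F : {set edge G} | (F != set0) && [exists X, F == cut X]] B].

(* The cardinality condition makes X1, X2, X3 distinct; parts of a partition
   are nonempty. *)
Definition tripartition X1 X2 X3 : bool :=
  [&& [exists C, component C && partition [set X1; X2; X3] C],
      #|[set X1; X2; X3]| == 3,
      [&& induced_connected X1, induced_connected X2 & induced_connected X3]
    & [&& joined X1 X2, joined X1 X3 & joined X2 X3]].

Definition tribond F : bool :=
  [exists X1, exists X2, exists X3,
    tripartition X1 X2 X3 && (F == cut X1 :|: cut X2 :|: cut X3)].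

Definition modular_pair B1 B2 : bool :=
  [&& B1 \in bonds, B2 \in bonds
    & n_components (~: (B1 :|: B2)) == n_components setT + 2].

Definition dibond F : bool :=
  [exists B1, exists B2, modular_pair B1 B2 && (F == B1 :|: B2)]
  && ~~ tribond F.

Definition linear_class (L : {set {set edge G}}) : Prop :=
  L \subset bonds /\
  forall X1 X2 X3, tripartition X1 X2 X3 ->
    (cut X1 \in L) + (cut X2 \in L) + (cut X3 \in L) != 2.

Definition trivial_class (L : {set {set edge G}}) : Prop := L = bonds.

(* F is the edge set of a cycle v_0 e_0 v_1 e_1 ... v_k e_k v_0 of length
   k + 1; length 1 is a loop and length 2 a pair of parallel links. As the
   vertices are distinct, k < #|vertex G| is no restriction. *)
Definition cycle_edges F : bool :=
  [exists k : 'I_#|vertex G|,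
   exists v : {ffun 'I_k.+1 -> vertex G}, exists e : {ffun 'I_k.+1 -> edge G},
    [&& injectiveb v, injectiveb e,
        [forall i, ends (e i) == [set v i; v (ordS i)]]
      & F == [set e i | i : 'I_k.+1]]].

Definition cycle_matroid : {set {set edge G}} :=
  [set F : {set edge G} | ~~ [exists C, cycle_edges C && (C \subset F)]].

Definition extension_cocircuits (L : {set {set edge G}}) :
    {set {set option (edge G)}} :=
  [set Some @: (B : {set edge G}) | B in bonds :&: L]
  :|: [set None |: Some @: (B : {set edge G}) | B in bonds :\: L]
  :|: [set Some @: (F : {set edge G}) | F in
        [set F : {set edge G} | (tribond F || dibond F)
                 && [forall B in L, ~~ (B \subset F)]]].

End Multigraph.

(* Main.v *)
(* The bonds of [G] are the minimal nonempty vectors of the cut space, a binary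
   vector space, so linear classes can be treated in any such space [W]. An edge
   set [F] is independent iff every edge of [F] is the only edge of [F] in some
   vector, and the corank of [A] is the binary logarithm of the number of vectors
   avoiding [A]. A pair of bonds is modular iff their union contains exactly four
   vectors: the empty one, the two bonds and their symmetric difference; the
   latter is a bond iff the pair is the first two bonds of a tripartition.
   Hence tribonds and dibonds together are the unions of modular pairs, and a
   linear class is a set of bonds containing with each modular pair its third
   bond, if there is one. As in Crapo's theorem, the extension attached to [L]
   has as independent sets containing [e0] the sets [e0 |: F], where [F] is
   independent and avoided by some bond outside [L]. *)
Require Import Defs.
From mathcomp Require Import all_boot.

Set Implicit Arguments.
Unset Strict Implicit.
Unset Printing Implicit Defensive.

(** * Binary spaces *)

(** Corank is handled as a count of vectors: translation by a vector through [x] shows that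
    demanding avoidance of [x] halves the count or leaves it unchanged, and this replaces a rank
    function throughout. [L] is meant to hold the bonds whose complementary hyperplane acquires [e0]
    in its closure, so [e0] may join an independent [F] as long as some hyperplane containing [F] is
    of the other kind. The delicate axiom is augmentation of a set containing [e0], since a new
    element may destroy the witnessing bond. Two candidates [x] and [y] are therefore kept
    available, and modular closure of [L] guarantees a witness for one of them. In the converse,
    [e0] not being a coloop gives [N] a base without [e0]; hence [N] has the rank of the cycle
    matroid, and a base through [e0] leaves an independent set avoided by exactly one bond. That
    [e0] is not a loop makes [L] miss some bond. As [N] is then the extension attached to its own
    [L], one computation of cocircuits serves both directions. *)

Section SymmetricDifference.

Variable T : finType.
Implicit Types A B C : {set T}.

Definition symd A B : {set T} := [set x | (x \in A) (+) (x \in B)].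

Lemma symdC A B : symd A B = symd B A.
Proof. by apply/setP=> x; rewrite !inE addbC. Qed.

Lemma symdA A B C : symd A (symd B C) = symd (symd A B) C.
Proof. by apply/setP=> x; rewrite !inE addbA. Qed.

Lemma symdd A : symd A A = set0.
Proof. by apply/setP=> x; rewrite !inE addbb. Qed.

Lemma symd0 A : symd A set0 = A.
Proof. by apply/setP=> x; rewrite !inE addbF. Qed.

Lemma sym0d A : symd set0 A = A.
Proof. by rewrite symdC symd0. Qed.

Lemma symdK A B : symd (symd B A) A = B.
Proof. by rewrite -symdA symdd symd0. Qed.

Lemma symd_inj A : injective (symd^~ A).
Proof. by move=> B C /(congr1 (symd^~ A)); rewrite !symdK. Qed.

Lemma symd_eq0 A B : (symd A B == set0) = (A == B).
Proof. by apply/eqP/eqP=> [h | ->]; rewrite ?symdd // -(symdK B A) h sym0d. Qed.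

Lemma symd_subU A B : symd A B \subset A :|: B.
Proof. by apply/subsetP=> x; rewrite !inE; do 2 case: (x \in _). Qed.

Lemma symd_disjoint A B C :
  [disjoint A & C] -> [disjoint B & C] -> [disjoint symd A B & C].
Proof.
move=> dA dB; rewrite disjoints_subset (subset_trans (symd_subU A B)) //.
by rewrite subUset -!disjoints_subset dA.
Qed.

Lemma disjoint_setU1 x A B : [disjoint A & x |: B] = (x \notin A) && [disjoint A & B].
Proof. by rewrite !disjoints_subset setCU subsetI subsetC sub1set inE. Qed.

End SymmetricDifference.

Section BinarySpace.

Variables (E : finType) (W : {set {set E}}).
Hypothesis W0 : set0 \in W.
Hypothesis WD : forall A B, A \in W -> B \in W -> symd A B \in W.
Implicit Types (A B F H K S : {set E}) (x y z : E).

Definition avoiding A : {set {set E}} := [set K in W | [disjoint K & A]].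

Definition cocirc : {set {set E}} :=
  [set B | minset [pred K : {set E} | (K != set0) && (K \in W)] B].

Definition indep : {set {set E}} :=
  [set F : {set E} | [forall e in F, exists K in W, K :&: F == [set e]]].

Definition modular B1 B2 : bool :=
  [&& B1 \in cocirc, B2 \in cocirc & #|avoiding (~: (B1 :|: B2))| == 4].

Lemma in_avoiding A K : (K \in avoiding A) = (K \in W) && [disjoint K & A].
Proof. by rewrite inE. Qed.

Lemma avoiding0 A : set0 \in avoiding A.
Proof. by rewrite inE W0 disjoints_subset sub0set. Qed.

Lemma avoiding_gt0 A : 0 < #|avoiding A|.
Proof. by apply/card_gt0P; exists set0; apply: avoiding0. Qed.

Lemma avoiding_symd A K J :
  K \in avoiding A -> J \in avoiding A -> symd K J \in avoiding A.
Proof.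
rewrite !in_avoiding => /andP[wK dK] /andP[wJ dJ].
by rewrite WD //= symd_disjoint.
Qed.

Lemma avoidingU1 x A K : (K \in avoiding (x |: A)) = (x \notin K) && (K \in avoiding A).
Proof. by rewrite !in_avoiding disjoint_setU1 andbCA. Qed.

Lemma avoidingS A B : A \subset B -> avoiding B \subset avoiding A.
Proof.
move=> sAB; apply/subsetP=> K; rewrite !in_avoiding => /andP[-> /=].
by apply: disjointWr.
Qed.

Lemma in_avoidingC A K : (K \in avoiding (~: A)) = (K \in W) && (K \subset A).
Proof. by rewrite in_avoiding disjoints_subset setCK. Qed.

(** Adding [K] exchanges the vectors of [avoiding A] through [x] with those missing [x], so exactly
    half survive the new constraint. *)
Lemma card_avoidingU1 x A K :
  K \in avoiding A -> x \in K -> #|avoiding A| = 2 * #|avoiding (x |: A)|.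
Proof.
move=> aK xK; rewrite -(cardsID [set J : {set E} | x \in J] (avoiding A)) mul2n -addnn.
have eqD : avoiding A :\: [set J : {set E} | x \in J] = avoiding (x |: A).
  by apply/setP=> J; rewrite avoidingU1 !inE.
congr (_ + _); last by rewrite eqD.
rewrite -(card_imset _ (@symd_inj _ K)); congr #|pred_of_set _|.
apply/setP=> J; apply/imsetP/idP => [[J' + ->] | aJ].
  rewrite 2!inE => /andP[aJ' xJ'].
  by rewrite avoidingU1 avoiding_symd // inE xJ' xK.
move: aJ; rewrite avoidingU1 => /andP[xJ aJ].
by exists (symd J K); rewrite ?symdK // inE avoiding_symd // !inE (negbTE xJ) xK.
Qed.

Lemma leq_card_avoidingU1 x A : #|avoiding A| <= 2 * #|avoiding (x |: A)|.
Proof.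
have [/existsP[K /andP[aK xK]]|] := boolP [exists K in avoiding A, x \in K].
  by rewrite (card_avoidingU1 aK xK).
rewrite negb_exists => /forallP h; rewrite mul2n -addnn.
apply: leq_trans (leq_addr _ _); apply/subset_leq_card/subsetP=> K aK.
by rewrite avoidingU1 aK andbT; move: (h K); rewrite aK.
Qed.

(** * Independent sets and exchange in a binary space *)

Lemma indepP F :
  reflect (forall e, e \in F -> exists2 K, K \in W & K :&: F = [set e])
          (F \in indep).
Proof.
rewrite inE; apply: (iffP forall_inP) => h e /h.
  by case/exists_inP=> K wK /eqP; exists K.
by case=> K wK hK; apply/exists_inP; exists K; rewrite ?hK.
Qed.

Lemma indep0 : set0 \in indep.
Proof. by apply/indepP=> e; rewrite inE. Qed.

Lemma indepS A B : A \subset B -> B \in indep -> A \in indep.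
Proof.
move=> sAB /indepP iB; apply/indepP=> e eA.
have [K wK hK] := iB e (subsetP sAB e eA).
exists K => //; rewrite -(setIidPr sAB) setIA hK; apply/setIidPl.
by rewrite sub1set.
Qed.

Lemma indepU1P x F : F \in indep -> x \notin F ->
  reflect (exists2 K, K \in avoiding F & x \in K) (x |: F \in indep).
Proof.
move=> /indepP iF xF; apply: (iffP (indepP _)) => [|[K aK xK]].
  move/(_ x (setU11 x F))=> [K wK hK]; exists K; last first.
    by have := set11 x; rewrite -hK => /setIP[].
  rewrite in_avoiding wK /= -setI_eq0 -subset0; apply/subsetP=> y /setIP[yK yF].
  have: y \in K :&: (x |: F) by rewrite in_setI yK setU1r.
  by rewrite hK => /set1P eyx; move: xF; rewrite -eyx yF.
move=> e; rewrite in_setU1; case/predU1P=> [->|eF].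
  move: aK; rewrite in_avoiding => /andP[wK dK].
  exists K => //; apply/setP=> y; rewrite !inE andb_orr.
  case: eqP => [->|_] /=; first by rewrite xK.
  by rewrite andbF -in_setI (disjoint_setI0 dK) inE.
have [J wJ hJ] := iF e eF; move: (aK); rewrite in_avoiding => /andP[wK dK].
have exN : x != e by apply: contraNneq xF => ->.
(* Adding [K] clears [x] from [J] and keeps the trace on [F], which [K] avoids. *)
pose J' := if x \in J then symd J K else J.
have wJ' : J' \in W by rewrite /J'; case: ifP => // _; apply: WD.
have xJ' : x \notin J' by rewrite /J'; case: ifP => [xJ|->//]; rewrite inE xJ xK.
have hJ' : J' :&: F = [set e].
  rewrite /J'; case: ifP => // _; rewrite -hJ; apply/setP=> y; rewrite !inE.
  have [yF|] := boolP (y \in F); last by rewrite !andbF.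
  by rewrite (disjointFl dK yF) addbF.
exists J' => //; apply/setP=> y; rewrite setIUr hJ' !inE.
by case: eqP => [->|_]; rewrite ?(negbTE xJ') ?andbF.
Qed.

(** Each element of [F] halves the count in turn: the rank formula in exponential form. *)
Lemma card_indep F : F \in indep -> #|avoiding F| * 2 ^ #|F| = #|avoiding set0|.
Proof.
have [n] := ubnP #|F|; elim: n F => // n IH F; rewrite ltnS => leFn iF.
have [->|[x xF]] := set_0Vmem F; first by rewrite cards0 muln1.
have iFx : F :\ x \in indep by apply: indepS iF; apply: subD1set.
have nxF : x \notin F :\ x by rewrite setD11.
have [|K aK xK] := elimT (indepU1P iFx nxF); first by rewrite setD1K.
rewrite -(IH (F :\ x)) ?(card_avoidingU1 aK xK) ?setD1K //.
  by rewrite (cardsD1 x F) xF expnS mulnA [2 * _]mulnC.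
by move: leFn; rewrite (cardsD1 x F) xF.
Qed.

Lemma avoiding_maximal A B : A \in indep ->
    (forall x, x \in B -> x \notin A -> x |: A \notin indep) ->
  avoiding A \subset avoiding B.
Proof.
move=> iA h; apply/subsetP=> K aK; rewrite in_avoiding; have := aK.
rewrite in_avoiding => /andP[-> dKA] /=; rewrite disjoint_sym disjoints_subset.
apply/subsetP=> x xB; rewrite inE; apply/negP=> xK.
have xA : x \notin A by rewrite (disjointFr dKA xK).
by have /negP[] := h x xB xA; apply/indepU1P => //; exists K.
Qed.

(** If no element of [B] enlarged [A], every vector avoiding [A] would avoid [B], although
    [card_indep] leaves fewer vectors avoiding the larger set. *)
Lemma indep_aug A B : A \in indep -> B \in indep -> #|A| < #|B| ->
  exists2 x, x \in B :\: A & x |: A \in indep.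
Proof.
move=> iA iB ltAB.
have [/existsP[x /andP[xBA iAx]]|] := boolP [exists x in B :\: A, x |: A \in indep].
  by exists x.
rewrite negb_exists => /forallP h.
have sAB : avoiding A \subset avoiding B.
  apply: avoiding_maximal => // x xB xA; apply/negP=> iAx.
  by have := h x; rewrite in_setD xA xB iAx.
have := card_indep iA; rewrite -(card_indep iB) => eqc.
have : #|avoiding B| * 2 ^ #|B| <= #|avoiding B| * 2 ^ #|A|.
  by rewrite -eqc leq_mul2r subset_leq_card ?orbT.
by rewrite leq_pmul2l ?avoiding_gt0 // leq_exp2l // leqNgt ltAB.
Qed.

Lemma avoiding_maximal_eq A B : A \in indep -> B \in indep -> #|A| = #|B| ->
    (forall x, x \in B -> x \notin A -> x |: A \notin indep) ->
  avoiding A = avoiding B.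
Proof.
move=> iA iB eAB h; apply/eqP; rewrite eqEcard avoiding_maximal //=.
have := card_indep iA; rewrite -(card_indep iB) eAB => /eqP.
by rewrite eqn_pmul2r ?expn_gt0 // => /eqP->.
Qed.

(** A maximal independent set between [A] and [S] acts as a basis of [S]; equality of the [avoiding]
    sets says that the closures agree. *)
Lemma indep_spanning A S : A \in indep -> A \subset S ->
  exists H, [/\ H \in indep, A \subset H, H \subset S & avoiding H = avoiding S].
Proof.
move=> iA sAS.
have [H /maxsetP[/andP[iH sHS] maxH] sAH] :=
  @maxset_exists _ [pred X : {set E} | (X \in indep) && (X \subset S)] A
    (introT andP (conj iA sAS)).
exists H; split=> //; apply/eqP; rewrite eqEsubset (avoidingS sHS) andbT.
apply/subsetP=> K aK; have := aK; rewrite !in_avoiding => /andP[-> dK] /=.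
rewrite disjoint_sym disjoints_subset; apply/subsetP=> x xS; rewrite inE.
apply/negP=> xK; have xH : x \notin H by rewrite (disjointFr dK xK).
have iHx : x |: H \in indep by apply/indepU1P => //; exists K.
have := maxH (x |: H); rewrite /= iHx subUset sub1set xS sHS subsetUr.
by move=> /(_ isT isT) eqH; rewrite -eqH setU11 in xH.
Qed.

Lemma cocircP B :
  reflect [/\ B != set0, B \in W
            & forall K, K \in W -> K != set0 -> K \subset B -> K = B]
          (B \in cocirc).
Proof.
rewrite inE; apply: (iffP minsetP) => /= [[/andP[nB wB] h] | [nB wB h]].
  by split=> // K wK nK sK; apply: h; rewrite ?nK.
by split=> [|K /andP[nK wK] sK]; rewrite ?nB //; apply: h.
Qed.

Lemma cocirc_sub K : K \in W -> K != set0 -> exists2 B, B \in cocirc & B \subset K.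
Proof.
move=> wK nK.
have [B minB sBK] := @minset_exists _ [pred K : {set E} | (K != set0) && (K \in W)] K
  (introT andP (conj nK wK)).
by exists B => //; rewrite inE.
Qed.

Lemma cocirc_inW B : B \in cocirc -> B \in W.
Proof. by case/cocircP. Qed.

Lemma cocirc_neq0 B : B \in cocirc -> B != set0.
Proof. by case/cocircP. Qed.

Lemma cocirc_sub_eq B1 B2 : B1 \in cocirc -> B2 \in cocirc -> B1 \subset B2 -> B1 = B2.
Proof. by move=> /cocircP[n1 w1 _] /cocircP[_ _ h]; apply: h. Qed.

Lemma avoiding_cocirc B : B \in cocirc -> avoiding (~: B) = [set set0; B].
Proof.
case/cocircP=> nB wB h; apply/setP=> K; rewrite in_avoidingC !inE.
apply/andP/orP => [[wK sK] | [] /eqP->]; last 1 first.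
- by split.
- by have [|nK] := eqVneq K set0; [left | right; apply/eqP/h].
by rewrite W0 sub0set.
Qed.

Lemma card_avoiding_cocirc B : B \in cocirc -> #|avoiding (~: B)| = 2.
Proof.
by move=> cB; rewrite avoiding_cocirc // cards2 eq_sym cocirc_neq0.
Qed.

(** Two vectors mean corank 1: [A] spans a hyperplane, and [B] is its complement. *)
Lemma avoiding_card2 A : #|avoiding A| = 2 ->
  exists2 B, B \in cocirc & avoiding A = [set set0; B].
Proof.
move=> c2; have [] := set_0Vmem (avoiding A :\ set0) => [eq0 | [K]].
  by move: c2; rewrite (cardsD1 set0) avoiding0 eq0 cards0.
rewrite !inE => /andP[nK /andP[wK dK]].
have [B cB sBK] := cocirc_sub wK nK; exists B => //.
apply/esym/eqP; rewrite eqEcard cards2 c2 eq_sym cocirc_neq0 //= andbT.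
rewrite subUset !sub1set avoiding0 in_avoiding cocirc_inW //=.
exact: disjointWl dK.
Qed.

Lemma avoiding_cocirc_sub A K : K \in avoiding A -> K != set0 ->
  exists B, [/\ B \in cocirc, B \subset K & B \in avoiding A].
Proof.
rewrite in_avoiding => /andP[wK dK] nK.
have [B cB sBK] := cocirc_sub wK nK; exists B.
by rewrite in_avoiding cocirc_inW ?(disjointWl sBK).
Qed.

Lemma second_cocirc A B1 : B1 \in cocirc -> B1 \in avoiding A -> #|avoiding A| != 2 ->
  exists B2, [/\ B2 \in cocirc, B1 != B2 & B2 \in avoiding A].
Proof.
move=> c1 a1 n2; have n1 := cocirc_neq0 c1.
have [K] : exists K, K \in avoiding A :\ set0 :\ B1.
  apply/card_gt0P; move: n2; rewrite (cardsD1 set0) avoiding0 (cardsD1 B1).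
  by rewrite in_setD1 n1 a1; case: #|_|.
rewrite !in_setD1 => /and3P[nK1 nK aK].
have [B [cB sBK aB]] := avoiding_cocirc_sub aK nK.
have [e1|] := eqVneq B1 B; last by exists B.
(* Here [B1] lies inside [K], so [symd K B1] is disjoint from [B1] and any cocircuit in it is
   new. *)
have aK1 : symd K B1 \in avoiding A by rewrite avoiding_symd.
have [|B2 [cB2 sB2 aB2]] := avoiding_cocirc_sub aK1; first by rewrite symd_eq0.
exists B2; split=> //; apply: contraNneq n1 => e12.
apply/eqP/setP=> x; rewrite inE; apply/negP=> x1.
have xK : x \in K by apply: (subsetP sBK); rewrite -e1.
by move: sB2; rewrite -e12 => /subsetP/(_ x x1); rewrite inE xK x1.
Qed.

Lemma two_cocirc A : 2 < #|avoiding A| ->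
  exists B1 B2, [/\ B1 \in cocirc, B2 \in cocirc, B1 != B2,
                   B1 \in avoiding A & B2 \in avoiding A].
Proof.
move=> lt2; have [K] : exists K, K \in avoiding A :\ set0.
  by apply/card_gt0P; move: lt2; rewrite (cardsD1 set0) avoiding0; case: #|_|.
rewrite in_setD1 => /andP[nK aK].
have [B1 [c1 _ a1]] := avoiding_cocirc_sub aK nK.
have [|B2 [c2 n12 a2]] := second_cocirc c1 a1; first by rewrite neq_ltn lt2 orbT.
by exists B1, B2.
Qed.

Lemma card_cocirc_span B1 B2 : B1 \in cocirc -> B2 \in cocirc -> B1 != B2 ->
  #|[set set0; B1; B2; symd B1 B2]| = 4.
Proof.
move=> c1 c2 n12; have [n1 n2] := (cocirc_neq0 c1, cocirc_neq0 c2).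
rewrite -setUA -setUA !cardsU1 cards1 !inE !negb_or.
rewrite ![set0 == _]eq_sym n1 n2 symd_eq0 n12 /=.
rewrite -[B1 == symd _ _]symd_eq0 symdA symdd sym0d n2 -symd_eq0.
by rewrite [symd B1 _]symdC symdA symdd sym0d n1.
Qed.

Lemma cocirc_span_sub B1 B2 : B1 \in cocirc -> B2 \in cocirc ->
  [set set0; B1; B2; symd B1 B2] \subset avoiding (~: (B1 :|: B2)).
Proof.
move=> c1 c2; have sub3 : symd B1 B2 \in avoiding (~: (B1 :|: B2)).
  by rewrite in_avoidingC symd_subU WD ?cocirc_inW.
rewrite !subUset !sub1set avoiding0 sub3 !in_avoidingC !cocirc_inW //.
by rewrite subsetUl subsetUr.
Qed.

Lemma modular_neq B1 B2 : modular B1 B2 -> B1 != B2.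
Proof.
case/and3P=> c1 c2 /eqP c4.
by apply/eqP=> e; move: c4; rewrite e setUid card_avoiding_cocirc.
Qed.

Lemma modular_avoiding B1 B2 : modular B1 B2 ->
  avoiding (~: (B1 :|: B2)) = [set set0; B1; B2; symd B1 B2].
Proof.
move=> m; have n12 := modular_neq m; case/and3P: m => c1 c2 /eqP c4.
apply/esym/eqP.
by rewrite eqEcard cocirc_span_sub //= card_cocirc_span // c4.
Qed.

(** Distinct cocircuits always span four distinct vectors, so an upper bound suffices. *)
Lemma modularI B1 B2 : B1 \in cocirc -> B2 \in cocirc -> B1 != B2 ->
  #|avoiding (~: (B1 :|: B2))| <= 4 -> modular B1 B2.
Proof.
move=> c1 c2 n12 le4; rewrite /modular c1 c2 eqn_leq le4 /=.
by rewrite -(card_cocirc_span c1 c2 n12) subset_leq_card ?cocirc_span_sub.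
Qed.

(** * Extension by a modular-closed set of cocircuits *)

Section Extension.

Variable L : {set {set E}}.
Implicit Types X Y : {set option E}.

Definition old X : {set E} := [set x | Some x \in X].

(** In matroid terms, [e0] is to lie outside the closure of [A]: some hyperplane containing [A]
    misses [e0]. *)
Definition evaded A : bool := [exists B in cocirc :\: L, [disjoint B & A]].

Definition ext : {set {set option E}} :=
  [set X | (old X \in indep) && ((None \in X) ==> evaded (old X))].

Definition modular_closed : Prop :=
  forall B1 B2, modular B1 B2 -> B1 \in L -> B2 \in L ->
    symd B1 B2 \in cocirc -> symd B1 B2 \in L.

Lemma evadedP A :
  reflect (exists B, [/\ B \in cocirc, B \notin L & [disjoint B & A]]) (evaded A).
Proof.
apply: (iffP exists_inP) => [[B] | [B [cB lB dB]]].
  by rewrite in_setD => /andP[]; exists B.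
by exists B; rewrite // in_setD lB.
Qed.

Lemma evadedS A B : A \subset B -> evaded B -> evaded A.
Proof.
move=> sAB /evadedP[K [cK lK dK]]; apply/evadedP; exists K.
by split=> //; apply: disjointWr dK.
Qed.

Lemma None_notin_Some A : None \notin Some @: A.
Proof. by apply/imsetP=> -[]. Qed.

Lemma old_Some A : old (Some @: A) = A.
Proof. by apply/setP=> x; rewrite inE mem_imset //; apply: Some_inj. Qed.

Lemma old_NoneU X : old (None |: X) = old X.
Proof. by apply/setP=> x; rewrite !inE. Qed.

Lemma old_SomeU x X : old (Some x |: X) = x |: old X.
Proof. by apply/setP=> y; rewrite !inE. Qed.

Lemma Some_old X : None \notin X -> Some @: old X = X.
Proof.
move=> nX; apply/setP=> -[x|]; last by rewrite (negbTE (None_notin_Some _)) (negbTE nX).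
by rewrite mem_imset ?inE //; apply: Some_inj.
Qed.

Lemma NoneU_Some_old X : None \in X -> None |: Some @: old X = X.
Proof.
move=> nX; apply/setP=> -[x|]; last by rewrite setU11 nX.
by rewrite in_setU1 mem_imset ?inE //; apply: Some_inj.
Qed.

Lemma card_old X : #|X| = (None \in X) + #|old X|.
Proof.
rewrite (cardsD1 None); congr (_ + _).
rewrite -(card_imset (mem (old X)) Some_inj); congr #|pred_of_set _|.
apply/setP=> -[x|]; last by rewrite setD11 (negbTE (None_notin_Some _)).
by rewrite mem_imset ?inE //; apply: Some_inj.
Qed.

Lemma ext_Some A : (Some @: A \in ext) = (A \in indep).
Proof. by rewrite inE old_Some (negbTE (None_notin_Some _)) andbT. Qed.

Lemma ext_None A : (None |: Some @: A \in ext) = (A \in indep) && evaded A.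
Proof. by rewrite inE old_NoneU old_Some setU11. Qed.

(* If the cocircuit [K0] outside [L] that avoids [A] contains both [x] and [y],
   then either [A] has corank 2, or a nonempty vector avoiding [A], [x] and [y]
   is not contained in the minimal vector [K0], so that [A] can be enlarged
   inside the complement of [K0]. *)
Lemma evaded_step A x y : modular_closed -> A \in indep ->
    y \notin x |: A -> y |: (x |: A) \in indep -> evaded A ->
  evaded (x |: A) || evaded (y |: A).
Proof.
move=> mL; have [n] := ubnP #|~: A|; elim: n A => // n IH A.
rewrite ltnS => len iA yxA iyxA /evadedP[K0 [cK0 lK0 dK0]].
have ev z : z \notin K0 -> evaded (z |: A).
  by move=> zK0; apply/evadedP; exists K0; rewrite disjoint_setU1 zK0.
have [xK0|/ev-> //] := boolP (x \in K0).
have [yK0|/ev->] := boolP (y \in K0); last by rewrite orbT.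
have wK0 := cocirc_inW cK0.
have aK0 : K0 \in avoiding A by rewrite in_avoiding wK0.
have ixA : x |: A \in indep by apply: indepS iyxA; apply: subsetUr.
have [K1 aK1 yK1] := elimT (indepU1P ixA yxA) iyxA.
have cA := card_avoidingU1 aK0 xK0; have cA' := card_avoidingU1 aK0 yK0.
have cxA := card_avoidingU1 aK1 yK1.
(* Four vectors avoid [A], two avoid [x |: A] and two avoid [y |: A]. Let [B1] and [B2] be the
   nonempty ones of the latter pairs. If both were in [L], they would form a modular pair whose
   third vector is [K0], and closure would put [K0] in [L]. *)
have [c1|] := eqVneq #|avoiding (y |: (x |: A))| 1.
  move: cxA; rewrite c1 => cxA.
  have cyA : #|avoiding (y |: A)| = 2.
    by apply/eqP; rewrite -(eqn_pmul2l (isT : 0 < 2)) -cA' cA cxA.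
  have [B1 cB1 eB1] := avoiding_card2 cxA.
  have [B2 cB2 eB2] := avoiding_card2 cyA.
  have aB1 : B1 \in avoiding (x |: A) by rewrite eB1 set22.
  have aB2 : B2 \in avoiding (y |: A) by rewrite eB2 set22.
  have dis B z : B \in avoiding (z |: A) -> [disjoint B & z |: A].
    by rewrite in_avoiding => /andP[].
  have [lB1|lB1] := boolP (B1 \in L); last first.
    by apply/orP; left; apply/evadedP; exists B1; rewrite cB1 lB1 dis.
  have [lB2|lB2] := boolP (B2 \in L); last first.
    by apply/orP; right; apply/evadedP; exists B2; rewrite cB2 lB2 dis.
  have n12 : B1 != B2.
    apply/eqP=> e12; move: (aB2); rewrite -e12 avoidingU1 => /andP[yB1 _].
    have aB1' : B1 \in avoiding (y |: (x |: A)) by rewrite avoidingU1 yB1.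
    move: c1; rewrite (cardsD1 set0) avoiding0 (cardsD1 B1) !inE -in_avoiding.
    by rewrite aB1' (cocirc_neq0 cB1).
  have sub : avoiding (~: (B1 :|: B2)) \subset avoiding A.
    apply: avoidingS; rewrite subsetC subUset -!disjoints_subset.
    have := dis _ _ aB1; have := dis _ _ aB2.
    by rewrite !disjoint_setU1 => /andP[_ ->] /andP[_ ->].
  have m12 : modular B1 B2.
    by apply: modularI => //; rewrite (leq_trans (subset_leq_card sub)) // cA cxA.
  have e4 : avoiding (~: (B1 :|: B2)) = avoiding A.
    apply/eqP; rewrite eqEcard sub cA cxA.
    by case/and3P: m12 => _ _ /eqP->.
  move: aK0; rewrite -e4 modular_avoiding // !inE (negbTE (cocirc_neq0 cK0)) /=.
  case/orP=> [/orP[]|] /eqP eK0; rewrite eK0 ?lB1 ?lB2 // in lK0 cK0.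
  by rewrite (mL _ _ m12) in lK0.
move=> c1; have [K' aK' nK'] : exists2 K', K' \in avoiding (y |: (x |: A)) & K' != set0.
  have [e0|[K']] := set_0Vmem (avoiding (y |: (x |: A)) :\ set0).
    by move: c1; rewrite (cardsD1 set0) e0 cards0 avoiding0.
  by rewrite in_setD1 => /andP[nK' aK']; exists K'.
have := aK'; rewrite !avoidingU1 => /and3P[yK' xK' aK'A].
have /subsetPn[z zK' zK0] : ~~ (K' \subset K0).
  apply: contra xK' => sK'; have [_ _ /(_ K') ->] // := cocircP _ cK0.
  by move: aK'A; rewrite in_avoiding => /andP[].
have dKz : z \notin A.
  by move: aK'A; rewrite in_avoiding => /andP[_ /disjointFr->].
have zxA : z \notin y |: (x |: A).
  by rewrite !in_setU1 !negb_or dKz !andbT; apply/andP; split;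
    [apply: contraNneq yK' | apply: contraNneq xK'] => <-.
have i3 : z |: (y |: (x |: A)) \in indep by apply/indepU1P => //; exists K'.
have i3' : y |: (x |: (z |: A)) \in indep.
  by rewrite [x |: (z |: A)]setUCA setUCA.
have iz : z |: A \in indep.
  by apply: indepS i3; rewrite setUS // subsetU // subsetUr orbT.
have yz : y \notin x |: (z |: A).
  move: yxA; rewrite !in_setU1 !negb_or => /andP[-> ->]; rewrite andbT.
  by apply: contraNneq yK' => ->.
have evz : evaded (z |: A) by apply: ev.
have ltn : #|~: (z |: A)| < n.
  apply: leq_trans len; rewrite setCU setIC -setDE [X in _ < X](cardsD1 z).
  by rewrite in_setC dKz.
by case/orP: (IH _ ltn iz yz i3' evz) => h; apply/orP; [left | right];
  apply: evadedS h; rewrite setUS ?subsetUr.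
Qed.

Lemma ext_aug : modular_closed -> forall X Y, X \in ext -> Y \in ext -> #|X| < #|Y| ->
  exists2 z, z \in Y :\: X & z |: X \in ext.
Proof.
move=> mL X Y; rewrite ![_ \in ext]inE => /andP[iX vX] /andP[iY vY].
rewrite !card_old; set A := old X in iX vX *; set B := old Y in iY vY *.
have old_mem Z x : (x \in old Z) = (Some x \in Z) by rewrite inE.
have addSome x : x \in B -> x \notin A -> x |: A \in indep ->
    ((None \in X) ==> evaded (x |: A)) ->
  exists2 z, z \in Y :\: X & z |: X \in ext.
  rewrite !old_mem => xY xX ixA vxA; exists (Some x); first by rewrite in_setD xX.
  by rewrite inE old_SomeU ixA in_setU1.
(* Without [None] in [X], failure to add an old element forces [None \in Y] and [#|A| = #|B|]; then
   the same vectors avoid [A] and [B], and the witness of [B] lets [None] be added. *)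
case nX: (None \in X) vX addSome => /=; last first.
  move=> _ addSome ltAB.
  have [/exists_inP[x]|] := boolP [exists x in B :\: A, x |: A \in indep].
    by rewrite in_setD => /andP[xA xB] /addSome; apply.
  rewrite negb_exists_in => /forall_inP mA.
  have leBA : #|B| <= #|A|.
    by rewrite leqNgt; apply/negP=> /(indep_aug iX iY)[x /mA/negP].
  case nY: (None \in Y) vY ltAB => /= vB; last by rewrite ltnNge leBA.
  rewrite !add0n add1n ltnS => leAB.
  exists None; first by rewrite in_setD nX nY.
  rewrite inE old_NoneU iX setU11 /=; move/evadedP: vB => [K [cK lK dK]].
  apply/evadedP; exists K; split=> //.
  have := avoiding_maximal_eq iX iY.
  move=> /(_ _ _)/setP/(_ K); rewrite !in_avoiding dK cocirc_inW //=; apply.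
    by apply/eqP; rewrite eqn_leq leAB.
  by move=> x xB xA; apply: mA; rewrite in_setD xA.
move=> vA addSome ltAB.
have ltAB' : #|A| < #|B|.
  by move: ltAB; case: (None \in Y) => //=; apply: leq_trans; rewrite add1n.
have [x] := indep_aug iX iY ltAB'; rewrite in_setD => /andP[xA xB] ixA.
have [/exists_inP[y]|] := boolP [exists y in B :\: (x |: A), y |: (x |: A) \in indep].
  rewrite in_setD => /andP[yxA yB] iyxA.
  case/orP: (evaded_step mL iX yxA iyxA vA) => v; first exact: addSome v.
  apply: addSome v => //.
    by move: yxA; rewrite in_setU1 negb_or => /andP[].
  by apply: indepS iyxA; rewrite setUS // subsetUr.
rewrite negb_exists_in => /forall_inP mxA.
have cxA : #|x |: A| = #|A|.+1 by rewrite cardsU1 xA.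
have leB : #|B| <= #|A|.+1.
  by rewrite -cxA leqNgt; apply/negP=> /(indep_aug ixA iY)[y /mxA/negP].
case nY: (None \in Y) vY ltAB => /= vB; last by rewrite add1n add0n ltnNge leB.
move=> _; have /evadedP[K [cK lK dK]] := vB.
apply: (addSome x) => //; apply/evadedP; exists K; split=> //.
have := avoiding_maximal_eq ixA iY.
move=> /(_ _ _)/setP/(_ K); rewrite !in_avoiding dK cocirc_inW //=; apply.
  by apply/eqP; rewrite cxA eqn_leq leB ltAB'.
by move=> y yB yxA; apply: mxA; rewrite in_setD yxA.
Qed.

Lemma ext_matroid : modular_closed -> is_matroid ext.
Proof.
move=> mL; split; last exact: ext_aug.
  have -> : set0 = Some @: (set0 : {set E}) by rewrite imset0.
  by rewrite ext_Some indep0.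
move=> X Y sXY; have sold : old X \subset old Y.
  by apply/subsetP=> x; rewrite !inE; apply: (subsetP sXY).
rewrite ![_ \in ext]inE => /andP[iY /implyP vY]; rewrite (indepS sold iY).
by apply/implyP=> /(subsetP sXY)/vY; apply: evadedS.
Qed.

(** * Bases and cocircuits of the extension *)

Lemma dualP X :
  reflect (exists2 Y, Y \in bases ext & [disjoint X & Y]) (X \in dual ext).
Proof.
rewrite inE; apply: (iffP exists_inP) => -[Y bY]; rewrite -?disjoints_subset => dXY.
  by exists Y; rewrite // disjoints_subset.
by exists Y; rewrite // -disjoints_subset.
Qed.

Lemma base_Some A : A \in indep -> #|avoiding A| = 1 -> Some @: A \in bases ext.
Proof.
move=> iA c1; have no_cocirc B : B \in cocirc -> B \notin avoiding A.
  move=> cB; apply/negP=> aB; move: c1.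
  by rewrite (cardsD1 set0) avoiding0 (cardsD1 B) in_setD1 cocirc_neq0 ?aB.
rewrite inE; apply/maxsetP; split; first by rewrite /= ext_Some.
move=> Y; rewrite /= [_ \in ext]inE => /andP[iY vY] sAY.
have nY : None \notin Y.
  apply/negP=> nY; move: vY; rewrite nY => /evadedP[B [cB _ dB]].
  case/negP: (no_cocirc B cB); rewrite in_avoiding cocirc_inW //=.
  apply: disjointWr dB; apply/subsetP=> x xA; rewrite inE (subsetP sAY) //.
  exact: imset_f.
have sAY' : A \subset old Y.
  by apply/subsetP=> x xA; rewrite inE (subsetP sAY) // imset_f.
rewrite -(Some_old nY); suff -> : old Y = A by [].
apply/eqP; rewrite eqEsubset sAY' andbT.
apply/subsetP=> x xY; apply/negPn/negP=> xA.
have ixA : x |: A \in indep.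
  by apply: indepS iY; rewrite subUset sub1set xY.
have [K aK xK] := elimT (indepU1P iA xA) ixA.
have nK : K != set0 by apply/set0Pn; exists x.
by have [B [cB _]] := avoiding_cocirc_sub aK nK; apply/negP/no_cocirc.
Qed.

Lemma base_None A : A \in indep -> #|avoiding A| = 2 -> evaded A ->
  None |: Some @: A \in bases ext.
Proof.
move=> iA c2 vA; rewrite inE; apply/maxsetP; split; first by rewrite /= ext_None iA.
move=> Y; rewrite /= [_ \in ext]inE => /andP[iY vY].
rewrite subUset sub1set => /andP[nY sAY].
move: vY; rewrite nY => /evadedP[B [cB _ dB]].
have sAY' : A \subset old Y.
  by apply/subsetP=> x xA; rewrite inE (subsetP sAY) // imset_f.
rewrite -(NoneU_Some_old nY); suff -> : old Y = A by [].
apply/eqP; rewrite eqEsubset sAY' andbT; apply/subsetP=> x xY; apply/negPn/negP=> xA.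
have ixA : x |: A \in indep.
  by apply: indepS iY; rewrite subUset sub1set xY.
have [K aK xK] := elimT (indepU1P iA xA) ixA.
move: c2; rewrite (card_avoidingU1 aK xK) (cardsD1 set0) avoiding0.
rewrite (cardsD1 B) in_setD1 cocirc_neq0 //= in_avoiding cocirc_inW //=.
have dBx : [disjoint B & x |: A].
  by apply: disjointWr dB; rewrite subUset sub1set xY.
by rewrite dBx !add1n !mulnS.
Qed.

(** Converse to [base_Some] and [base_None]: a base without [None] spans everything, and one with
    [None] spans a hyperplane whose cocircuit is outside [L]. *)
Lemma bases_ext X : X \in bases ext ->
  if None \in X then evaded (old X) /\ #|avoiding (old X)| = 2
  else #|avoiding (old X)| = 1.
Proof.
rewrite inE => /maxsetP[]; rewrite /= [_ \in ext]inE => /andP[iX vX] maxX.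
have add x : Some x |: X \in ext -> x \in old X.
  by move=> /(maxX _)/(_ (subsetUr _ _)) <-; rewrite inE setU11.
case nX : (None \in X) vX => /= vX.
  split=> //; move/evadedP: (vX) => [B [cB lB dB]].
  have aB : B \in avoiding (old X) by rewrite in_avoiding cocirc_inW.
  (* A second cocircuit would supply an element outside [B], which could be added with [B] still as
     witness. *)
  apply/eqP/negPn/negP=> /(second_cocirc cB aB)[B2 [cB2 nB aB2]].
  have /subsetPn[x x2 xB] : ~~ (B2 \subset B).
    by apply: contra nB => s; rewrite (cocirc_sub_eq cB2 cB s).
  have xX : x \notin old X.
    by move: aB2; rewrite in_avoiding => /andP[_ /disjointFr->].
  case/negP: (xX); apply: add; rewrite inE old_SomeU.
  apply/andP; split; first by apply/indepU1P => //; exists B2.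
  by apply/implyP=> _; apply/evadedP; exists B; rewrite disjoint_setU1 xB.
apply/eqP; rewrite (cardsD1 set0) avoiding0 -[1]addn0 eqn_add2l cards_eq0.
apply/eqP/setP=> K; rewrite in_setD1 in_set0; apply/negP=> /andP[/set0Pn[x xK] aK].
have xX : x \notin old X.
  by move: aK; rewrite in_avoiding => /andP[_ /disjointFr->].
case/negP: (xX); apply: add; rewrite inE old_SomeU in_setU1 nX andbT.
by apply/indepU1P => //; exists K.
Qed.

Lemma spanning_avoiding A : exists H, [/\ H \in indep, H \subset ~: A
  & avoiding H = avoiding (~: A)].
Proof. by have [H []] := indep_spanning indep0 (sub0set (~: A)); exists H. Qed.

Lemma in_avoidingC_cocirc A B : B \in cocirc -> (B \in avoiding (~: A)) = (B \subset A).
Proof. by move=> cB; rewrite in_avoidingC cocirc_inW. Qed.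

Lemma not_dual_cocirc X : X \notin dual ext ->
  exists2 B, B \in cocirc & B \subset old X.
Proof.
move=> dX; have [H [iH sH eH]] := spanning_avoiding (old X).
have [e0|[K]] := set_0Vmem (avoiding H :\ set0).
  case/dualP: dX; exists (Some @: H).
    by apply: base_Some; rewrite // (cardsD1 set0) e0 cards0 avoiding0.
  rewrite disjoint_sym disjoints_subset; apply/subsetP=> _ /imsetP[x xH ->].
  by have := subsetP sH x xH; rewrite !inE.
rewrite in_setD1 => /andP[nK]; rewrite eH => aK.
have [B [cB _]] := avoiding_cocirc_sub aK nK.
by rewrite in_avoidingC_cocirc //; exists B.
Qed.

(** Only bases without [None] can miss this set, and these are the bases of the old matroid,
    whatever [L] is. *)
Lemma not_dual_None A :
  reflect (exists2 B, B \in cocirc & B \subset A) (None |: Some @: A \notin dual ext).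
Proof.
apply: (iffP idP) => [/not_dual_cocirc | [B cB sB]].
  by rewrite old_NoneU old_Some.
apply/dualP=> -[Y /bases_ext]; case: ifP => [nY _|nY c1] dAY.
  by rewrite (disjointFr dAY (setU11 _ _)) in nY.
have aB : B \in avoiding (old Y).
  rewrite in_avoiding cocirc_inW //= disjoints_subset; apply/subsetP=> x xB.
  rewrite !inE (disjointFr dAY) // in_setU1 imset_f ?orbT //.
  exact: (subsetP sB).
move: c1; rewrite (cardsD1 set0) avoiding0 (cardsD1 B).
by rewrite in_setD1 cocirc_neq0 ?aB.
Qed.

(** A base without [None] misses [A] only if [A] contains no cocircuit. A base with [None] tolerates
    exactly one cocircuit in [A], provided it is outside [L]. The two alternatives are the ways of
    defeating both kinds of base. *)
Lemma not_dual_Some A :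
  reflect ((exists B, [/\ B \in cocirc, B \in L & B \subset A]) \/
           exists B1 B2, [/\ B1 \in cocirc, B2 \in cocirc, B1 != B2,
                            B1 \subset A & B2 \subset A])
          (Some @: A \notin dual ext).
Proof.
apply: (iffP idP) => [dA | hA].
  have [B cB] := not_dual_cocirc dA; rewrite old_Some => sB.
  have [lB|lB] := boolP (B \in L); [by left; exists B | right].
  have [H [iH sH eH]] := spanning_avoiding A.
  have aB : B \in avoiding H by rewrite eH in_avoidingC_cocirc.
  have [c2|] := eqVneq #|avoiding H| 2; last first.
    move=> /(second_cocirc cB aB)[B2 [cB2 nB aB2]].
    by exists B, B2; rewrite eH in_avoidingC_cocirc // in aB2.
  case/dualP: dA; exists (None |: Some @: H).
    apply: base_None => //; apply/evadedP; exists B; split=> //.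
    by move: aB; rewrite in_avoiding => /andP[].
  rewrite disjoint_setU1 None_notin_Some disjoints_subset /=.
  apply/subsetP=> _ /imsetP[x xA ->]; rewrite inE mem_imset; last exact: Some_inj.
  by apply/negP=> /(subsetP sH); rewrite inE xA.
apply/dualP=> -[Y /bases_ext bY dAY].
have sub B : B \in cocirc -> B \subset A -> B \in avoiding (old Y).
  move=> cB sB; rewrite in_avoiding cocirc_inW //= disjoints_subset.
  apply/subsetP=> x xB; rewrite !inE (disjointFr dAY) // imset_f //.
  exact: (subsetP sB).
move: bY; case: ifP => nY; last first.
  have [B cB sB] : exists2 B, B \in cocirc & B \subset A.
    by case: hA => [[B [cB _ sB]] | [B [_ [cB _ _ sB _]]]]; exists B.
  rewrite (cardsD1 set0) avoiding0 (cardsD1 B).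
  by rewrite in_setD1 cocirc_neq0 ?sub.
case=> /evadedP[K [cK lK dK]] c2.
have only B : B \in cocirc -> B \subset A -> B = K.
  move=> cB sB; apply/eqP/negPn/negP=> nBK; move: c2.
  rewrite (cardsD1 set0) avoiding0 (cardsD1 B) in_setD1 cocirc_neq0 ?sub //.
  rewrite (cardsD1 K) !in_setD1 cocirc_neq0 // eq_sym nBK in_avoiding.
  by rewrite cocirc_inW ?dK.
case: hA => [[B [cB lB sB]] | [B1 [B2 [c1 c2' n12 s1 s2]]]].
  by move: lK; rewrite -(only B cB sB) lB.
by move: n12; rewrite (only B1 c1 s1) (only B2 c2' s2) eqxx.
Qed.

Hypothesis sL : L \subset cocirc.

Lemma cocircuits_None A : (None |: Some @: A \in cocircuits ext) = (A \in cocirc :\: L).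
Proof.
rewrite inE; apply/minsetP/idP; rewrite /=.
  case=> /not_dual_None[B cB sB] minA.
  have eBA : B = A.
    have dB : None |: Some @: B \notin dual ext by apply/not_dual_None; exists B.
    have sNB := setUS [set None] (imsetS Some sB).
    by have := congr1 old (minA (None |: Some @: B) dB sNB); rewrite !old_NoneU !old_Some.
  rewrite -eBA in minA *; rewrite in_setD cB andbT; apply/negP=> lB.
  have dB : Some @: B \notin dual ext by apply/not_dual_Some; left; exists B.
  have /setP/(_ None) := minA (Some @: B) dB (subsetUr _ _).
  by rewrite setU11 (negbTE (None_notin_Some _)).
rewrite in_setD => /andP[lA cA]; split; first by apply/not_dual_None; exists A.
move=> Y; rewrite /= => dY sY.
have sYA : old Y \subset A.
  by apply/subsetP=> x; rewrite inE => /(subsetP sY); rewrite in_setU1 mem_imset //;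
    apply: Some_inj.
have [nY|nY] := boolP (None \in Y).
  rewrite -(NoneU_Some_old nY) in dY *; suff -> : old Y = A by [].
  have [B cB sB] := elimT (not_dual_None _) dY.
  apply/eqP; rewrite eqEsubset sYA -{1}(cocirc_sub_eq cB cA) //.
  exact: subset_trans sYA.
rewrite -(Some_old nY) in dY; case/not_dual_Some: dY.
  case=> B [cB lB sB]; case/negP: lA.
  by rewrite -(cocirc_sub_eq cB cA) // (subset_trans sB).
case=> B1 [B2 [c1 c2 n12 s1 s2]]; move: n12.
by rewrite (cocirc_sub_eq c1 cA (subset_trans s1 sYA))
  (cocirc_sub_eq c2 cA (subset_trans s2 sYA)) eqxx.
Qed.

Lemma cocircuits_Some A : (Some @: A \in cocircuits ext) =
  (A \in cocirc :&: L)
  || [exists B1, exists B2, modular B1 B2 && (A == B1 :|: B2)]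
     && [forall B in L, ~~ (B \subset A)].
Proof.
have subY Y : Y \subset Some @: A -> Some @: old Y = Y /\ old Y \subset A.
  move=> sY; have nY : None \notin Y.
    by apply: contra (None_notin_Some A) => /(subsetP sY).
  rewrite Some_old //; split=> //; apply/subsetP=> x; rewrite inE => /(subsetP sY).
  by rewrite mem_imset //; apply: Some_inj.
rewrite inE; apply/minsetP/idP; rewrite /=.
  case=> dA minA; have minA' A' : A' \subset A -> Some @: A' \notin dual ext -> A' = A.
    move=> sA dA'; rewrite -(old_Some A') (minA (Some @: A')) ?old_Some //.
    exact: imsetS.
  apply/orP; have [/exists_inP[B lB sB]|] := boolP [exists B in L, B \subset A].
    left; have cB := subsetP sL B lB.
    rewrite -(minA' B) ?in_setI ?cB //; apply/not_dual_Some.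
    by left; exists B.
  rewrite negb_exists_in => noL; right; rewrite noL andbT.
  case/not_dual_Some: dA => [[B [cB lB sB]] | [B1 [B2 [c1 c2 n12 s1 s2]]]].
    by have /forall_inP/(_ B lB)/negP := noL.
  have eA : B1 :|: B2 = A.
    apply: minA'; first by rewrite subUset s1.
    by apply/not_dual_Some; right; exists B1, B2; rewrite subsetUl subsetUr.
  apply/existsP; exists B1; apply/existsP; exists B2; rewrite eA eqxx andbT.
  (* With more than four vectors in [A], deleting one element [x] leaves more than two, hence two
     cocircuits inside [A :\ x], against minimality. *)
  apply: modularI => //; rewrite eA leqNgt; apply/negP=> lt4.
  have /set0Pn[x x1] := cocirc_neq0 c1.
  have lt2 : 2 < #|avoiding (x |: ~: A)|.
    by rewrite -(ltn_pmul2l (isT : 0 < 2)); apply: leq_trans (leq_card_avoidingU1 _ _).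
  have eC : x |: ~: A = ~: (A :\ x) by rewrite setCD setUC.
  have [J1 [J2 [cJ1 cJ2 nJ a1 a2]]] := two_cocirc lt2.
  rewrite eC !in_avoidingC_cocirc // in a1 a2.
  have dAx : Some @: (A :\ x) \notin dual ext.
    by apply/not_dual_Some; right; exists J1, J2.
  have /setP/(_ x) := minA' (A :\ x) (subD1set _ _) dAx.
  by rewrite setD11 (subsetP s1).
case/orP=> [|/andP[/existsP[B1 /existsP[B2 /andP[m /eqP eA]]] /forall_inP noL]].
  rewrite in_setI => /andP[cA lA]; split.
    by apply/not_dual_Some; left; exists A.
  move=> Y; rewrite /= => dY /subY[eY sY]; rewrite -eY in dY *.
  suff -> : old Y = A by [].
case/not_dual_Some: dY => [[B [cB _ sB]] | ].
    apply/eqP; rewrite eqEsubset sY -{1}(cocirc_sub_eq cB cA) //.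
    exact: subset_trans sY.
  case=> C1 [C2 [c1 c2 n12 s1 s2]]; move: n12.
  by rewrite (cocirc_sub_eq c1 cA (subset_trans s1 sY))
    (cocirc_sub_eq c2 cA (subset_trans s2 sY)) eqxx.
have [c1 c2 _] := and3P m; split.
  apply/not_dual_Some; right; exists B1, B2; rewrite eA subsetUl subsetUr.
  by rewrite modular_neq.
move=> Y; rewrite /= => dY /subY[eY sY]; rewrite -eY in dY *.
suff -> : old Y = A by [].
case/not_dual_Some: dY => [[B [cB lB sB]] | ].
  by case/negP: (noL B lB); apply: subset_trans sY.
(* Any two of [B1], [B2] and [symd B1 B2] already cover [B1 :|: B2]. *)
case=> C1 [C2 [cC1 cC2 nC s1 s2]].
have inS C : C \in cocirc -> C \subset old Y -> C \in [set B1; B2; symd B1 B2].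
  move=> cC sC; have : C \in avoiding (~: (B1 :|: B2)).
    by rewrite in_avoidingC_cocirc // -eA (subset_trans sC).
  by rewrite modular_avoiding // !inE (negbTE (cocirc_neq0 cC)).
have sC : C1 :|: C2 \subset old Y by rewrite subUset s1.
apply/eqP; rewrite eqEsubset sY; apply: subset_trans sC.
rewrite eA; apply/subsetP=> x xB.
have := inS C1 cC1 s1; have := inS C2 cC2 s2; move: xB nC.
rewrite !inE -!orbA => xB nC /or3P[] /eqP e2 /or3P[] /eqP e1;
  move: nC xB; rewrite e1 e2 ?eqxx ?inE //;
  by do 2 case: (x \in _).
Qed.

Lemma ext_not_loop B : B \in cocirc -> B \notin L -> ~~ loop ext None.
Proof.
move=> cB lB; rewrite /loop inE; apply/negP=> /minsetP[/negP h _]; case: h.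
rewrite -[[set None]]setU0 -(imset0 Some) ext_None indep0.
by apply/evadedP; exists B; rewrite disjoints_subset setC0 subsetT.
Qed.

(** A coloop would be the cocircuit [None |: Some @: set0], but members of [cocirc] are nonempty. *)
Lemma ext_not_coloop : ~~ coloop ext None.
Proof.
rewrite /coloop /loop -/(cocircuits ext) -[[set None]]setU0 -(imset0 Some).
by rewrite cocircuits_None in_setD; apply/negP=> /andP[_ /cocirc_neq0/eqP].
Qed.

End Extension.

(** * Every extension arises this way *)

Section Converse.

Variable N : {set {set option E}}.
Hypothesis matN : is_matroid N.
Hypothesis restrN : [set A : {set E} | Some @: A \in N] = indep.
Hypothesis ncoloopN : ~~ coloop N None.
Implicit Types X Y : {set option E}.

(* The [B] such that [None] lies in the closure of the complement of [B] in [N]. *)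
Definition unextended : {set {set E}} :=
  [set B in cocirc | [forall H in indep,
    (#|avoiding H| == 2) && [disjoint B & H] ==> (None |: Some @: H \notin N)]].

Lemma in_N_Some A : (Some @: A \in N) = (A \in indep).
Proof. by rewrite -restrN inE. Qed.

Lemma N_sub X Y : X \subset Y -> Y \in N -> X \in N.
Proof. by case: matN => _ /(_ X Y). Qed.

Lemma N_indep A : None |: Some @: A \in N -> A \in indep.
Proof. by rewrite -in_N_Some; apply: N_sub; apply: subsetUr. Qed.

Lemma card_SomeU A : #|None |: Some @: A| = #|A|.+1.
Proof. by rewrite cardsU1 None_notin_Some card_imset //; apply: Some_inj. Qed.

Lemma SomeU1 x A : Some x |: Some @: A = Some @: (x |: A).
Proof. by rewrite imsetU1. Qed.

Lemma avoiding_unique A B K : #|avoiding A| = 2 -> B \in avoiding A -> B != set0 ->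
  K \in avoiding A -> K != set0 -> K = B.
Proof.
move=> c2 aB nB aK nK; apply/eqP/negPn/negP=> nKB; move: c2.
by rewrite (cardsD1 set0) avoiding0 (cardsD1 B) in_setD1 nB aB (cardsD1 K) !in_setD1
  nKB nK aK.
Qed.

Lemma aug_None A H : A \in indep -> None |: Some @: H \in N -> #|A| <= #|H| ->
    (forall x, x \in H -> x \notin A -> x |: A \notin indep) ->
  None |: Some @: A \in N.
Proof.
move=> iA nH leAH mA; have [_ _ aug] := matN.
have [||| z] := aug (Some @: A) (None |: Some @: H); rewrite ?in_N_Some //.
  by rewrite card_SomeU card_imset //; apply: Some_inj.
case: z => [x|] //; rewrite in_setD in_setU1 !mem_imset; try exact: Some_inj.
by case/andP=> xA xH; rewrite SomeU1 in_N_Some (negbTE (mA x xH xA)).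
Qed.

(** One basis of the hyperplane [~: B] decides for all of them. An element of [H] enlarging [H']
    would lie in a vector avoiding [H'], but [B] is the only such nonempty vector and it misses [H];
    so augmentation from [None |: Some @: H] must add [None]. *)
Lemma extend_None B H H' : B \in cocirc -> H \in indep -> H' \in indep ->
    #|avoiding H| = 2 -> #|avoiding H'| = 2 -> [disjoint B & H] -> [disjoint B & H'] ->
  None |: Some @: H \in N -> None |: Some @: H' \in N.
Proof.
move=> cB iH iH' c2 c2' dH dH' nH; apply: (aug_None iH' nH) => [|x xH xH'].
  have := card_indep iH; rewrite -(card_indep iH') c2 c2' => /eqP.
  by rewrite eqn_pmul2l // eqn_exp2l // => /eqP->.
apply/negP=> /(elimT (indepU1P iH' xH'))[K aK xK].
have aB : B \in avoiding H' by rewrite in_avoiding cocirc_inW.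
have nK : K != set0 by apply/set0Pn; exists x.
have eKB := avoiding_unique c2' aB (cocirc_neq0 cB) aK nK.
by rewrite eKB (disjointFl dH xH) in xK.
Qed.

Lemma unextendedP B :
  reflect (B \in cocirc /\ forall H, H \in indep -> #|avoiding H| = 2 ->
             [disjoint B & H] -> None |: Some @: H \notin N)
          (B \in unextended).
Proof.
rewrite [_ \in unextended]inE; apply: (iffP andP) => [[cB /forall_inP h] | [cB h]]; split=> //.
  by move=> H iH c2 dB; apply: (implyP (h H iH)); rewrite c2.
by apply/forall_inP=> H iH; apply/implyP=> /andP[/eqP c2]; apply: h.
Qed.

Lemma not_unextendedP B : B \in cocirc -> B \notin unextended ->
  exists H, [/\ H \in indep, #|avoiding H| = 2, [disjoint B & H]
              & None |: Some @: H \in N].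
Proof.
rewrite [_ \in unextended]inE => -> /=; rewrite negb_forall_in => /exists_inP[H iH].
by rewrite negb_imply negbK => /andP[/andP[/eqP c2 dB] nH]; exists H.
Qed.

(** As [None] is not a coloop, [[set None]] is coindependent, so some base misses it; maximality of
    that base among the old elements gives corank 0. *)
Lemma exists_base_Some : exists2 A : {set E}, Some @: A \in bases N & #|avoiding A| = 1.
Proof.
have [N0 _ _] := matN.
have [D0 bD0 _] := @maxset_exists _ [pred X : {set option E} | X \in N] set0 N0.
have d0 : set0 \in dual N.
  by rewrite inE; apply/exists_inP; exists D0; rewrite ?inE ?sub0set.
have : [set None] \in dual N.
  apply: contraNT ncoloopN => nd; rewrite /coloop /loop inE; apply/minsetP.
  split=> // Y /= dY; rewrite subset1 => /orP[/eqP-> // | /eqP Y0].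
  by rewrite Y0 d0 in dY.
rewrite inE => /exists_inP[D bD]; rewrite sub1set inE => nD.
have eD := Some_old nD; exists (old D); first by rewrite eD.
move: bD; rewrite inE => /maxsetP[/= ND maxD].
have iD : old D \in indep by rewrite -in_N_Some eD.
apply/eqP; rewrite (cardsD1 set0) avoiding0 -[1]addn0 eqn_add2l cards_eq0.
apply/eqP/setP=> K; rewrite in_setD1 in_set0; apply/negP=> /andP[/set0Pn[x xK] aK].
have xD : x \notin old D.
  by move: aK; rewrite in_avoiding => /andP[_ /disjointFr->].
have NxD : Some x |: D \in N.
  by rewrite -{1}eD SomeU1 in_N_Some; apply/indepU1P => //; exists K.
by rewrite inE -(maxD _ NxD (subsetUr _ _)) setU11 in xD.
Qed.

Lemma card_bases X Y : X \in bases N -> Y \in bases N -> #|X| <= #|Y|.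
Proof.
rewrite !inE => /maxsetP[/= NX _] /maxsetP[/= NY maxY].
rewrite leqNgt; apply/negP=> lt; have [_ _ aug] := matN.
have [z] := aug Y X NY NX lt; rewrite in_setD => /andP[zY _] NzY.
by rewrite -(maxY _ NzY (subsetUr _ _)) setU11 in zY.
Qed.

Lemma N_evaded F : (None |: Some @: F \in N) = (F \in indep) && evaded unextended F.
Proof.
apply/idP/andP=> [NF | [iF /evadedP[B [cB uB dB]]]].
  split; first exact: N_indep.
  have [A bA cA] := exists_base_Some.
  have [D bD sD] := @maxset_exists _ [pred X : {set option E} | X \in N] _ NF.
  have nD : None \in D by apply: (subsetP sD); apply: setU11.
  rewrite -(NoneU_Some_old nD) in bD; set H := old D in bD.
  have sFH : F \subset H.
    apply/subsetP=> x xF; rewrite inE; apply: (subsetP sD).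
    by rewrite in_setU1 imset_f ?orbT.
  have bD' : None |: Some @: H \in bases N by rewrite inE.
  have /= NH := maxsetp bD; have iH := N_indep NH.
  (* Bases have equal size, so [H] is one element short of a basis of the old matroid and has corank
     1. *)
  have cAH : #|A| = #|H|.+1.
    rewrite -card_SomeU -(card_imset (mem A) Some_inj).
    by apply/eqP; rewrite eqn_leq !card_bases.
  have iA : A \in indep by move: bA; rewrite inE => /maxsetp; rewrite /= in_N_Some.
  have c2 : #|avoiding H| = 2.
    have := card_indep iH; rewrite -(card_indep iA) cA mul1n cAH expnS => /eqP.
    by rewrite eqn_pmul2r ?expn_gt0 // => /eqP.
  have [B cB eB] := avoiding_card2 c2.
  have dB : [disjoint B & H].
    by have : B \in avoiding H; [rewrite eB set22 | rewrite in_avoiding => /andP[]].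
  apply/evadedP; exists B; split=> //; last exact: disjointWr dB.
  by apply/negP=> /unextendedP[_ /(_ H iH c2 dB)/negP].
have [H [iH c2 dH NH]] := not_unextendedP cB uB.
(* A basis of [~: B] through [F] spans the same hyperplane as [H], so [extend_None] lets [None] join
   it, and then join its subset [F]. *)
have sF : F \subset ~: B by rewrite -disjoints_subset disjoint_sym.
have [F' [iF' sFF' sF' eF']] := indep_spanning iF sF.
have NF' : None |: Some @: F' \in N.
  apply: (extend_None cB iH iF' c2 _ dH) => //.
    by rewrite eF' card_avoiding_cocirc.
  by rewrite disjoint_sym disjoints_subset.
by apply: N_sub NF'; rewrite setUS // imsetS.
Qed.

Lemma extension_is_ext : N = ext unextended.
Proof.
apply/setP=> X; have [nX|nX] := boolP (None \in X).
  by rewrite -(NoneU_Some_old nX) N_evaded ext_None.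
by rewrite -(Some_old nX) in_N_Some ext_Some.
Qed.

(* [H] spans the complement of [B1 :|: B2]. If the third cocircuit were extended,
   [None |: H] would be independent and could be augmented from [x2 |: (x1 |: H)]
   inside the complement of [B1] or of [B2]. *)
Lemma unextended_modular_closed : modular_closed unextended.
Proof.
move=> B1 B2 m u1 u2 c3; have [c1 c2 /eqP c4] := and3P m.
apply/negPn/negP=> u3; have [H3 [iH3 cH3 dH3 NH3]] := not_unextendedP c3 u3.
have [H [iH sH eH]] := spanning_avoiding (B1 :|: B2).
have [dH1 dH2] : [disjoint B1 & H] /\ [disjoint B2 & H].
  by move: sH; rewrite -subsetC subUset -!disjoints_subset => /andP[-> ->].
have NH : None |: Some @: H \in N.
  have sH3 : H \subset ~: symd B1 B2.
    by apply: subset_trans sH _; rewrite setCS symd_subU.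
  have [H' [iH' sHH' sH' eH']] := indep_spanning iH sH3.
  have NH' : None |: Some @: H' \in N.
    apply: (extend_None c3 iH3 iH' cH3 _ dH3) => //.
      by rewrite eH' card_avoiding_cocirc.
    by rewrite disjoint_sym disjoints_subset.
  by apply: N_sub NH'; rewrite setUS // imsetS.
have n12 := modular_neq m.
have [aB1 aB2] : B1 \in avoiding H /\ B2 \in avoiding H.
  by rewrite eH !in_avoidingC_cocirc // subsetUl subsetUr.
(* As [H] has corank 2, one element of [C2] outside [C1] completes it to a basis of [~: C1], where
   [unextended] forbids [None]. *)
have step C1 C2 x : C1 \in unextended -> C1 \in avoiding H -> C2 \in avoiding H ->
    x \in C2 -> x \notin C1 -> None |: Some @: (x |: H) \notin N.
  move=> u a1 a2 xC2 xC1; have [_] := unextendedP _ u; apply.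
  - have xH : x \notin H by move: a2; rewrite in_avoiding => /andP[_ /disjointFr->].
    by apply/indepU1P => //; exists C2.
  - apply/eqP; rewrite -(eqn_pmul2l (isT : 0 < 2)) -(card_avoidingU1 a2 xC2).
    by rewrite eH c4.
  by rewrite disjoint_setU1 xC1; move: a1; rewrite in_avoiding => /andP[].
have /subsetPn[x1 x1B2 x1B1] : ~~ (B2 \subset B1).
  by apply: contra n12 => s; rewrite (cocirc_sub_eq c2 c1 s).
have /subsetPn[x2 x2B1 x2B2] : ~~ (B1 \subset B2).
  by apply: contra n12 => s; rewrite (cocirc_sub_eq c1 c2 s).
have N1 := step _ _ _ u1 aB1 aB2 x1B2 x1B1.
have N2 := step _ _ _ u2 aB2 aB1 x2B1 x2B2.
have x1H : x1 \notin H by rewrite (disjointFr dH2 x1B2).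
have x2H : x2 \notin H by rewrite (disjointFr dH1 x2B1).
have iH1 : x1 |: H \in indep by apply/indepU1P => //; exists B2.
have x21 : x2 \notin x1 |: H.
  by rewrite in_setU1 (negbTE x2H) orbF; apply: contraNneq x1B1 => <-.
have iH12 : x2 |: (x1 |: H) \in indep.
  by apply/indepU1P => //; exists B1; rewrite // avoidingU1 x1B1.
have [_ _ aug] := matN.
have [||| z] := aug (None |: Some @: H) (Some @: (x2 |: (x1 |: H))).
- by [].
- by rewrite in_N_Some.
- rewrite card_SomeU card_imset; last exact: Some_inj.
  by rewrite cardsU1 x21 cardsU1 x1H.
rewrite in_setD => /andP[zH /imsetP[x xH ez]]; rewrite {z}ez in zH *.
rewrite setUCA SomeU1; move: xH; rewrite !in_setU1 => /or3P[] /eqP ex.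
- by rewrite ex (negbTE N2).
- by rewrite ex (negbTE N1).
by move: zH; rewrite in_setU1 imset_f //; apply/eqP.
Qed.

Lemma unextended_sub : unextended \subset cocirc.
Proof. by apply/subsetP=> B /unextendedP[]. Qed.

Lemma unextended_nontrivial : ~~ loop N None ->
  exists2 B, B \in cocirc & B \notin unextended.
Proof.
move=> nl; have : None |: Some @: (set0 : {set E}) \in N.
  apply: contraNT nl; rewrite imset0 setU0 => nN; rewrite /loop inE; apply/minsetP.
  split=> // Y /= dY; rewrite subset1 => /orP[/eqP-> // | /eqP Y0].
  by case: matN => N0; rewrite Y0 N0 in dY.
by rewrite N_evaded => /andP[_ /evadedP[B [cB uB _]]]; exists B.
Qed.

End Converse.

End BinarySpace.

(** * The cut space of a multigraph *)

Section Cuts.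

Variable G : multigraph.
Implicit Types (X Y Z C : {set vertex G}) (B F : {set edge G}) (e : edge G).
Implicit Types (x y u v : vertex G).

Lemma endsP e : exists x y, ends e = [set x; y].
Proof.
have /andP[c0] := card_ends e; rewrite leq_eqVlt => /orP[/cards2P[x [y [_ ->]]]|c1].
  by exists x, y.
have /cards1P[x ->] : #|ends e| == 1 by rewrite eqn_leq c0 -ltnS c1.
by exists x, x; rewrite setUid.
Qed.

(** Allowing [x = y] covers loops too: both sides are then false. *)
Lemma mem_cut e x y X : ends e = [set x; y] -> (e \in cut X) = (x \in X) (+) (y \in X).
Proof.
move=> exy; rewrite inE /link exy cards2.
have [->|nxy] := eqVneq x y; first by rewrite addbb.
have s1 z : [set z] :&: X = if z \in X then [set z] else set0.
  by case: ifP => zX; [apply/setIidPl | apply/disjoint_setI0];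
    rewrite ?sub1set ?disjoints1 ?zX.
rewrite setIUl !s1; case: (x \in X); case: (y \in X);
  by rewrite ?setU0 ?set0U ?cards2 ?cards1 ?cards0 ?nxy.
Qed.

Lemma cut_symd X Y : cut (symd X Y) = symd (cut X) (cut Y).
Proof.
apply/setP=> e; have [x [y exy]] := endsP e.
by rewrite [RHS]inE !(mem_cut _ exy) !inE addbACA.
Qed.

Lemma cut0 : cut set0 = set0 :> {set edge G}.
Proof. by apply/setP=> e; have [x [y exy]] := endsP e; rewrite (mem_cut _ exy) !inE. Qed.

Lemma cutP e X :
  reflect (exists u v, [/\ ends e = [set u; v], u \in X & v \notin X]) (e \in cut X).
Proof.
apply: (iffP idP) => [|[u [v [euv uX vX]]]].
  have [x [y exy]] := endsP e; rewrite (mem_cut _ exy); case xX: (x \in X); case yX: (y \in X) => // _.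
    by exists x, y; rewrite yX.
  by exists y, x; rewrite setUC xX.
by rewrite (mem_cut _ euv) uX (negbTE vX).
Qed.

Definition cuts : {set {set edge G}} := [set cut X | X in [set: {set vertex G}]].

Lemma mem_cuts X : cut X \in cuts.
Proof. by apply: imset_f; rewrite inE. Qed.

Lemma cutsP B : reflect (exists X, B = cut X) (B \in cuts).
Proof. by apply: (iffP imsetP) => [[X _ ->]|[X ->]]; exists X. Qed.

Lemma cuts0 : set0 \in cuts.
Proof. by rewrite -cut0 mem_cuts. Qed.

Lemma cutsD A B : A \in cuts -> B \in cuts -> symd A B \in cuts.
Proof. by move=> /cutsP[X ->] /cutsP[Y ->]; rewrite -cut_symd mem_cuts. Qed.

Lemma bonds_cocirc : bonds G = cocirc cuts.
Proof.
apply/setP=> B; rewrite !inE; apply: minset_eq => F /=; congr (_ && _).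
by apply/existsP/cutsP => -[X] => [/eqP|] ->; exists X.
Qed.

Lemma adj_sym F : symmetric (@adj G F).
Proof. by move=> x y; apply: eq_existsb => e; rewrite setUC. Qed.

Lemma connect_adjC F : connect_sym (@adj G F).
Proof. exact/sym_connect_sym/adj_sym. Qed.

Lemma disjoint_cutP F X :
  reflect (forall x y, adj F x y -> (x \in X) = (y \in X)) [disjoint cut X & F].
Proof.
apply: (iffP idP) => [dX x y /exists_inP[e eF /eqP exy] | cX].
  by have /negbT := disjointFl dX eF; rewrite (mem_cut _ exy); do 2 case: (_ \in X).
rewrite disjoint_sym disjoints_subset; apply/subsetP=> e eF; rewrite inE.
have [x [y exy]] := endsP e; rewrite (mem_cut _ exy) (cX x y) ?addbb //.
by apply/exists_inP; exists e; rewrite ?exy.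
Qed.

Lemma connect_cut F X x y :
  [disjoint cut X & F] -> connect (adj F) x y -> (x \in X) = (y \in X).
Proof. by move=> /disjoint_cutP cX /(closed_connect cX). Qed.

(** An edge [e] of an acyclic [F] separates its ends in [F :\ e], and the component of one end there
    has a cut meeting [F] only in [e]. Otherwise a simple path closed by [e] would be a cycle; a
    loop is the case of an empty path. *)
Lemma cycle_matroid_sub : cycle_matroid G \subset indep cuts.
Proof.
apply/subsetP=> F; rewrite inE => /negP nC; apply/indepP=> e eF.
have [x [y exy]] := endsP e; pose F' := F :\ e.
have [/connectP[p0 /shortenP[p pp up _] ey] | nxy] := boolP (connect (adj F') x y).
  case: nC; pose k := size p; pose w := nth x (x :: p).
  have ltk : k < #|vertex G|.
    by rewrite -[k.+1]/(size (x :: p)) -(card_uniqP up) max_card.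
  have winj i j : i <= k -> j <= k -> w i = w j -> i = j.
    by move=> ik jk /eqP; rewrite nth_uniq // => /eqP.
  (* The default [e] is never taken for [i < k], where the path supplies an edge of [F']. *)
  pose g i := odflt e [pick f in F' | ends f == [set w i; w i.+1]].
  have gP i : i < k -> g i \in F' /\ ends (g i) = [set w i; w i.+1].
    move=> ik; rewrite /g; case: pickP => [f /andP[fF /eqP] //|no].
    have /exists_inP[f fF /eqP ef] : adj F' (w i) (w i.+1) by apply/(pathP x).
    by have := no f; rewrite /= fF ef eqxx.
  pose v := [ffun i : 'I_k.+1 => w i].
  pose ee := [ffun i : 'I_k.+1 => if i < k then g i else e].
  have eF' : e \notin F' by rewrite setD11.
  apply/existsP; exists [set ee i | i : 'I_k.+1]; apply/andP; split; last first.
    apply/subsetP=> _ /imsetP[i _ ->]; rewrite ffunE; case: ifP => // /gP[].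
    by rewrite in_setD1 => /andP[].
  apply/existsP; exists (Ordinal ltk); apply/existsP; exists v.
  apply/existsP; exists ee; apply/and4P; split=> //.
  - apply/injectiveP=> i j; rewrite !ffunE => /winj h; apply: val_inj.
    by apply: h; rewrite -ltnS.
  (* If two path edges coincided, [w i] would be [w j] or [w j.+1] with [i < j], against
     distinctness of the vertices. *)
  - have inj2 (i j : 'I_k.+1) : i < j -> ee i != ee j.
      move=> ij; have ik : i < k by apply: leq_trans ij _; rewrite -ltnS.
      rewrite !ffunE ik; have [gi ei] := gP i ik; case: ifP => [jk|_]; last first.
        by apply: contraNneq eF' => <-.
      have [gj ej] := gP j jk; apply: contraTneq ij => egg.
      have := set21 (w i) (w i.+1); rewrite -ei egg ej => /set2P[] /winj -> //.
      - by rewrite ltnn.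
      - exact: ltnW.
      - exact: ltnW.
      - by rewrite -leqNgt.
      exact: ltnW.
    apply/injectiveP=> i j eij; apply: val_inj; apply/eqP.
    by case: (ltngtP i j) => // /inj2; rewrite eij eqxx.
  apply/forallP=> i; rewrite !ffunE /=; case: ifP => [ik|/negbT].
    by rewrite modn_small ?ltnS //; have [_ ->] := gP i ik.
  rewrite -leqNgt => ki; have -> : nat_of_ord i = k.
    by apply/eqP; rewrite eqn_leq ki -ltnS ltn_ord.
  rewrite modnn exy setUC ey; apply/eqP; congr [set _; _].
  by rewrite /w -last_nth.
exists (cut [set z | connect (adj F') x z]); first exact: mem_cuts.
apply/setP=> f; rewrite in_setI in_set1; have [->|nfe] := eqVneq f e.
  by rewrite eF (mem_cut _ exy) !inE connect0 (negbTE nxy).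
have [fF|] := boolP (f \in F); last by rewrite andbF.
have [a [b eab]] := endsP f; rewrite (mem_cut _ eab) !inE andbT.
have ab : adj F' a b by apply/exists_inP; exists f; rewrite ?eab // in_setD1 nfe.
by rewrite (same_connect_r (connect_adjC F') (connect1 ab)) addbb.
Qed.

(** Parity: a cycle meets every cut evenly, as the sum around it counts each vertex twice, whereas
    independence gives a cut meeting it in a single edge. *)
Lemma indep_cycle_matroid : indep cuts \subset cycle_matroid G.
Proof.
apply/subsetP=> F /indepP iF; rewrite inE; apply/existsP=> -[C /andP[]].
case/existsP=> k /existsP[v /existsP[ee /and4P[_ /injectiveP einj /forallP eE /eqP ->]]].
move=> /subsetP sF; have eF i : ee i \in F by apply/sF/imset_f.
have [_ /cutsP[X ->] hX] := iF _ (eF ord0).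
have inX i : (ee i \in cut X) = (i == ord0).
  have /setP/(_ (ee i)) := hX; rewrite in_setI eF andbT in_set1 => ->.
  by apply/eqP/eqP => [/einj|->].
have : \big[addb/false]_i (ee i \in cut X) = true.
  rewrite (bigD1 ord0) //= inX eqxx big1 // => i ni.
  by rewrite inX (negbTE ni).
rewrite (eq_bigr (fun i => (v i \in X) (+) (v (ordS i) \in X))); last first.
  by move=> i _; rewrite (mem_cut _ (eqP (eE i))).
by rewrite big_split /= [X in X (+) _](reindex_inj (@ordS_inj _)) addbb.
Qed.

Lemma cycle_matroid_indep : cycle_matroid G = indep cuts.
Proof. by apply/eqP; rewrite eqEsubset cycle_matroid_sub indep_cycle_matroid. Qed.

Definition uncut F : {set {set vertex G}} := [set X | [disjoint cut X & F]].

(** Such a vertex set is a union of components of the subgraph with edge set [F], recorded by the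
    component roots that it contains. *)
Lemma card_uncut F : #|uncut F| = 2 ^ n_components F.
Proof.
have symF := connect_adjC F; pose R := [set x | roots (adj F) x].
pose f (S : {set vertex G}) := [set x | root (adj F) x \in S].
have -> : uncut F = f @: powerset R.
  apply/setP=> X; rewrite inE; apply/idP/imsetP => [dX | [S _ ->]].
    exists (X :&: R); first by rewrite powersetE subsetIr.
    apply/setP=> x; rewrite !inE roots_root // andbT.
    exact: connect_cut dX (connect_root _ x).
  apply/disjoint_cutP=> x y xy; rewrite !inE.
  by have /eqP-> : root (adj F) x == root (adj F) y by rewrite root_connect ?connect1.
rewrite card_in_imset => [|S1 S2]; last first.
  rewrite !powersetE => s1 s2 e12.
  have cap (S : {set vertex G}) : S \subset R -> S = f S :&: R.
    move=> sS; apply/setP=> x; rewrite !inE.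
    case rx : (roots (adj F) x); first by rewrite andbT (eqP rx).
    by rewrite andbF; apply: contraFF rx => /(subsetP sS); rewrite inE.
  by rewrite (cap _ s1) (cap _ s2) e12.
rewrite card_powerset; congr (_ ^ _); rewrite /n_components /n_comp_mem.
by apply: eq_card => x; rewrite !inE andbT.
Qed.

(** The fibres of [cut] on [uncut F] are translates of its kernel [uncut setT], so corank is a
    difference of component counts. *)
Lemma card_avoiding_cuts F :
  #|avoiding cuts F| * 2 ^ n_components [set: edge G] = 2 ^ n_components F.
Proof.
rewrite -!card_uncut -[RHS]sum1_card.
rewrite (partition_big (@cut G) (fun K => K \in avoiding cuts F)) => [|X]; last first.
  by rewrite [_ \in uncut F]inE in_avoiding mem_cuts.
rewrite -sum_nat_const; apply: eq_bigr => K.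
rewrite in_avoiding => /andP[/cutsP[Y ->] dY].
rewrite sum1_card -(card_imset (mem (uncut setT)) (@symd_inj _ Y)).
apply: eq_card => X; rewrite [in RHS]unfold_in.
apply/imsetP/andP => [[Z + ->] | [_ /eqP cX]].
  rewrite inE -setI_eq0 setIT => /eqP cZ.
  by rewrite inE cut_symd cZ sym0d eqxx.
exists (symd X Y); last by rewrite symdK.
by rewrite inE cut_symd cX symdd -setI_eq0 set0I.
Qed.

Lemma modular_pair_modular B1 B2 : modular_pair B1 B2 = modular cuts B1 B2.
Proof.
rewrite /modular_pair /modular bonds_cocirc; congr [&& _, _ & _].
have pos : 0 < 2 ^ n_components [set: edge G] by rewrite expn_gt0.
rewrite -[#|_| == 4](eqn_pmul2r pos) card_avoiding_cuts -[4]/(2 ^ 2) -expnD.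
by rewrite eqn_exp2l // addnC.
Qed.

(** * Tripartitions and their bonds *)

Definition tri C X1 X2 X3 : Prop :=
  [/\ component C, X1 :|: X2 :|: X3 = C,
      [/\ [disjoint X1 & X2], [disjoint X1 & X3] & [disjoint X2 & X3]],
      [/\ induced_connected X1, induced_connected X2 & induced_connected X3]
    & [/\ joined X1 X2, joined X1 X3 & joined X2 X3]].

Lemma joinedC X Y : joined X Y = joined Y X.
Proof.
apply/exists_inP/exists_inP => -[x xX /exists_inP[y yX a]];
  by exists y => //; apply/exists_inP; exists x; rewrite // adj_sym.
Qed.

Lemma tri_swap12 C X1 X2 X3 : tri C X1 X2 X3 -> tri C X2 X1 X3.
Proof.
case=> cC eC [d12 d13 d23] [i1 i2 i3] [j12 j13 j23].
by split; rewrite // 1?joinedC 1?[X2 :|: X1]setUC 1?disjoint_sym.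
Qed.

Lemma tri_swap23 C X1 X2 X3 : tri C X1 X2 X3 -> tri C X1 X3 X2.
Proof.
case=> cC eC [d12 d13 d23] [i1 i2 i3] [j12 j13 j23].
by split; rewrite // 1?[joined X3 X2]joinedC 1?setUAC 1?[[disjoint X3 & X2]]disjoint_sym.
Qed.

Lemma induced_connected_neq0 X : induced_connected X -> X != set0.
Proof. by case/andP. Qed.

Lemma disjoint_neq X Y : X != set0 -> [disjoint X & Y] -> X != Y.
Proof. by move=> nX dXY; apply: contraNneq nX => e; rewrite -setI_eq0 -e setIid in dXY. Qed.

Lemma tripartitionP X1 X2 X3 :
  reflect (exists C, tri C X1 X2 X3) (tripartition X1 X2 X3).
Proof.
apply: (iffP and4P) => [[] | [C]].
  case/existsP=> C /andP[cC /and3P[/eqP cov /trivIsetP tr _]] c3.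
  move=> /and3P[i1 i2 i3] /and3P[j12 j13 j23]; exists C.
  have in1 : X1 \in [set X1; X2; X3] by rewrite !inE eqxx.
  have in2 : X2 \in [set X1; X2; X3] by rewrite !inE eqxx orbT.
  have in3 : X3 \in [set X1; X2; X3] by rewrite !inE eqxx orbT.
  have n12 : X1 != X2.
    by apply: contraTneq c3 => ->; rewrite setUid cards2; case: (X2 != X3).
  have n13 : X1 != X3.
    by apply: contraTneq c3 => ->; rewrite setUAC setUid cards2; case: (X3 != X2).
  have n23 : X2 != X3.
    by apply: contraTneq c3 => ->; rewrite -setUA setUid cards2; case: (X1 != X3).
  split=> //; last by split; apply: tr.
  by rewrite -cov /cover !bigcup_setU !big_set1.
case=> cC eC [d12 d13 d23] [i1 i2 i3] [j12 j13 j23].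
have [n1 [n2 n3]] := (induced_connected_neq0 i1,
  (induced_connected_neq0 i2, induced_connected_neq0 i3)).
have [n12 n13 n23] := And3 (disjoint_neq n1 d12) (disjoint_neq n1 d13) (disjoint_neq n2 d23).
split; [ | | exact/and3P | exact/and3P ].
  apply/existsP; exists C; rewrite cC /=; apply/and3P; split.
  - by rewrite /cover !bigcup_setU !big_set1 eC.
  - apply/trivIsetP=> A B; rewrite !inE -!orbA.
    by case/or3P=> /eqP-> /or3P[] /eqP->; rewrite ?eqxx // disjoint_sym.
  by rewrite !inE ![set0 == _]eq_sym !negb_or n1 n2.
by rewrite -setUA !cardsU1 cards1 !inE negb_or n12 n13 n23.
Qed.

Lemma mem_component C x y : component C -> x \in C -> connect (adj setT) x y = (y \in C).
Proof.
case/existsP=> z /eqP->; rewrite !inE => zx.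
by rewrite (same_connect (connect_adjC _) zx).
Qed.

Lemma component_ends C e x y : component C -> ends e = [set x; y] -> (x \in C) = (y \in C).
Proof.
move=> cC exy; have sub u v : ends e = [set u; v] -> u \in C -> v \in C.
  move=> euv uC; rewrite -(mem_component _ cC uC); apply: connect1.
  by apply/exists_inP; exists e; rewrite ?euv.
by apply/idP/idP; apply: sub; rewrite // setUC.
Qed.

Lemma cut_component C : component C -> cut C = set0.
Proof.
move=> cC; apply/setP=> e; have [x [y exy]] := endsP e.
by rewrite (mem_cut _ exy) inE (component_ends cC exy) addbb.
Qed.

Lemma cut_eq0 C X : component C -> X \subset C -> cut X = set0 -> X = set0 \/ X = C.
Proof.
move=> cC sX cX; have [->|[x xX]] := set_0Vmem X; [by left | right].
apply/eqP; rewrite eqEsubset sX; apply/subsetP=> y yC.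
have xy : connect (adj setT) x y by rewrite (mem_component _ cC) // (subsetP sX).
by rewrite -(connect_cut _ xy) // cX -setI_eq0 set0I.
Qed.

Lemma induced_const X Y x y : induced_connected X ->
  [disjoint cut Y & [set e | ends e \subset X]] -> x \in X -> y \in X ->
  (x \in Y) = (y \in Y).
Proof.
case/andP=> _ /forall_inP iX dY xX yX.
by apply: connect_cut dY _; move/forall_inP: (iX x xX); apply.
Qed.

Lemma inside_notin_cut X Y e : ends e \subset X -> X \subset Y \/ [disjoint X & Y] ->
  e \notin cut Y.
Proof.
have [x [y exy]] := endsP e; rewrite exy subUset !sub1set => /andP[xX yX].
rewrite (mem_cut _ exy) => -[/subsetP s | d]; first by rewrite !s.
by rewrite !(disjointFr d).
Qed.

Lemma joined_cut X Y : [disjoint X & Y] -> joined X Y = (cut X :&: cut Y != set0).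
Proof.
move=> d; apply/exists_inP/set0Pn => [[x xX /exists_inP[y yY]] | [e /setIP[]]].
  case/exists_inP=> e _ /eqP exy; exists e; rewrite in_setI !(mem_cut _ exy).
  by rewrite xX (disjointFl d yY) yY (disjointFr d xX).
case/cutP=> x [y [exy xX yX]]; rewrite (mem_cut _ exy) (disjointFr d xX) => yY.
by exists x => //; apply/exists_inP; exists y => //; apply/exists_inP; exists e; rewrite ?exy.
Qed.

(** [symd X1 X2] is the complement of [X3] in [C], and the cut of a component is empty. *)
Lemma tri_cut3 C X1 X2 X3 : tri C X1 X2 X3 -> cut X3 = symd (cut X1) (cut X2).
Proof.
case=> cC eC [d12 d13 d23] _ _.
rewrite -cut_symd; have -> : symd X1 X2 = symd C X3.
  apply/setP=> x; rewrite -eC !inE; have [x1|x1] := boolP (x \in X1).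
    by rewrite (disjointFr d12 x1) (disjointFr d13 x1).
  by have [x2|x2] := boolP (x \in X2); rewrite ?(disjointFr d23 x2) //= addbb.
by rewrite cut_symd (cut_component cC) sym0d.
Qed.

(* [Y] is constant on each part, with values [b1], [b2], [b3], say; up to
   complementing [Y] in [C] one may take [b3 = false]. *)
Lemma tri_avoiding C X1 X2 X3 : tri C X1 X2 X3 ->
  avoiding (@cuts) (~: (cut X1 :|: cut X2))
    \subset [set set0; cut X1; cut X2; symd (cut X1) (cut X2)].
Proof.
move=> t; have := t; case=> cC eC [d12 d13 d23] [i1 i2 i3] _.
apply/subsetP=> J; rewrite in_avoidingC => /andP[/cutsP[Y ->] /subsetP sJ].
have const Z : induced_connected Z -> Z \subset X1 \/ [disjoint Z & X1] ->
    Z \subset X2 \/ [disjoint Z & X2] -> exists b, forall z, z \in Z -> (z \in Y) = b.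
  move=> iZ h1 h2; have /set0Pn[z0 z0Z] := induced_connected_neq0 iZ.
  exists (z0 \in Y) => z zZ; apply: (induced_const iZ) => //.
  rewrite disjoint_sym disjoints_subset; apply/subsetP=> e; rewrite inE => eZ.
  rewrite in_setC; apply/negP=> eY; have := sJ e eY; rewrite in_setU.
  by rewrite (negbTE (inside_notin_cut eZ h1)) (negbTE (inside_notin_cut eZ h2)).
have [||b1 hb1] := const _ i1; [by left | by right |].
have [||b2 hb2] := const _ i2; [by right; rewrite disjoint_sym | by left |].
have [||b3 hb3] := const _ i3; [by right; rewrite disjoint_sym
  | by right; rewrite disjoint_sym |].
have eY : cut Y = cut (symd (if b1 (+) b3 then X1 else set0)
                            (if b2 (+) b3 then X2 else set0)).
  apply/setP=> e; have [x [y exy]] := endsP e.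
  have [xC|xC] := boolP (x \in C); last first.
    have yC : y \notin C by rewrite -(component_ends cC exy).
    have notin (Z : {set vertex G}) z : Z \subset C -> z \notin C -> (z \in Z) = false.
      by move=> s; apply: contraNF => /(subsetP s).
    have [s1 s2] : X1 \subset C /\ X2 \subset C.
      by rewrite -eC -setUA subsetUl setUCA subsetUl.
    transitivity false.
      apply/negP=> /sJ; rewrite in_setU !(mem_cut _ exy).
      by rewrite !(notin X1) // !(notin X2).
    rewrite (mem_cut _ exy) !inE; case: (b1 (+) b3); case: (b2 (+) b3);
      by rewrite ?(notin X1) ?(notin X2) ?inE.
  have yC : y \in C by rewrite -(component_ends cC exy).
  have val z : z \in C -> (z \in symd (if b1 (+) b3 then X1 else set0)
                            (if b2 (+) b3 then X2 else set0)) = (z \in Y) (+) b3.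
    rewrite -eC inE [z \in _ :|: _]inE => /orP[/orP[]|] zX.
    - rewrite (hb1 _ zX); case: (b1 (+) b3); case: (b2 (+) b3);
      by rewrite inE ?zX ?(disjointFr d12 zX) ?inE.
    - rewrite (hb2 _ zX); case: (b1 (+) b3); case: (b2 (+) b3);
      by rewrite inE ?zX ?(disjointFl d12 zX) ?inE.
    - rewrite (hb3 _ zX) addbb; case: (b1 (+) b3); case: (b2 (+) b3);
      by rewrite inE ?(disjointFl d13 zX) ?(disjointFl d23 zX) ?inE.
  by rewrite !(mem_cut _ exy) !val // addbACA addbb addbF.
rewrite eY cut_symd; case: (b1 (+) b3); case: (b2 (+) b3);
  by rewrite ?cut0 ?symd0 ?sym0d !in_setU !in_set1 eqxx ?orbT.
Qed.

(** An edge joining [X2] to [X3] lies in both their cuts but not in that of [X1]. *)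
Lemma tri_not_sub C X1 X2 X3 : tri C X1 X2 X3 ->
  ~~ (cut X2 \subset cut X1) && ~~ (cut X3 \subset cut X1).
Proof.
move=> t; have c3 := tri_cut3 t; case: t => _ _ [_ _ d23] _ [_ _].
rewrite joined_cut // => /set0Pn[e /setIP[e2 e3]].
have e1 : e \notin cut X1.
  by apply/negP=> e1; rewrite c3 inE e1 e2 in e3.
by apply/andP; split; apply/subsetPn; exists e.
Qed.

Lemma tri_cocirc C X1 X2 X3 : tri C X1 X2 X3 -> cut X1 \in cocirc cuts.
Proof.
move=> t; have /andP[n21 n31] := tri_not_sub t; have c3 := tri_cut3 t.
apply/cocircP; split=> [||J wJ nJ sJ]; last 2 first.
- exact: mem_cuts.
- have /(subsetP (tri_avoiding t)) : J \in avoiding cuts (~: (cut X1 :|: cut X2)).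
    by rewrite in_avoidingC wJ (subset_trans sJ) // subsetUl.
  rewrite !in_setU !in_set1 (negbTE nJ) -c3 -orbA => /or3P[] /eqP eJ //.
    by rewrite -eJ sJ in n21.
  by rewrite -eJ sJ in n31.
case: t => _ _ [d12 _ _] _ [j12 _ _]; move: j12; rewrite joined_cut //.
by apply: contraNneq => ->; rewrite set0I.
Qed.

Lemma tri_modular C X1 X2 X3 : tri C X1 X2 X3 -> modular cuts (cut X1) (cut X2).
Proof.
move=> t; have c1 := tri_cocirc t; have c2 := tri_cocirc (tri_swap12 t).
have n12 : cut X1 != cut X2.
  by have /andP[n21 _] := tri_not_sub t; apply: contraNneq n21 => ->.
apply: (modularI cuts0 cutsD) => //.
rewrite -(card_cocirc_span c1 c2 n12); apply: subset_leq_card.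
exact: tri_avoiding t.
Qed.

Lemma bond_induced_connected C X : component C -> X \subset C -> cut X \in cocirc cuts ->
  induced_connected X.
Proof.
move=> cC sX cX; have ncX := cocirc_neq0 cX.
have nX : X != set0 by apply: contraNneq ncX => ->; rewrite cut0.
apply/andP; split=> //.
have propX Y : Y \subset X -> cut Y = set0 -> Y = set0.
  move=> sY /(cut_eq0 cC (subset_trans sY sX))[//|eY]; case/negP: ncX.
  suff -> : X = C by rewrite cut_component.
  by apply/eqP; rewrite eqEsubset sX -{1}eY.
set F := [set e | ends e \subset X].
apply/forall_inP=> x xX; apply/forall_inP=> y yX.
(* The part of [X] reached from [x] inside [X] cuts only edges of [cut X], so by minimality it has
   the same cut; the rest of [X] then has empty cut and is empty. *)
pose X0 := [set z in X | connect (adj F) x z].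
have x0 : x \in X0 by rewrite inE xX connect0.
have sX0 : X0 \subset X by apply/subsetP=> z; rewrite inE => /andP[].
have s0 : cut X0 \subset cut X.
  apply/subsetP=> e /cutP[u [v [euv u0 v0]]]; apply/cutP; exists u, v.
  move: u0; rewrite inE => /andP[uX xu]; split=> //; apply: contra v0 => vX.
  rewrite inE vX (connect_trans xu) //; apply: connect1; apply/exists_inP.
  by exists e; rewrite ?euv // inE euv subUset !sub1set uX.
have n0 : cut X0 != set0.
  by apply/eqP=> /(propX _ sX0) e0; rewrite e0 inE in x0.
have e0 : cut X0 = cut X by case/cocircP: cX => _ _; apply; rewrite ?mem_cuts.
have : symd X X0 = set0.
  apply: propX; first by rewrite (subset_trans (symd_subU _ _)) // subUset subxx.
  by rewrite cut_symd e0 symdd.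
move/eqP; rewrite symd_eq0 => /eqP eX.
by move: yX; rewrite {1}eX inE => /andP[].
Qed.

(** Intersecting any side of [B] with the component keeps [e], so minimality preserves the cut;
    complementing in the component then puts [x] on the chosen side. *)
Lemma bond_side B e x y : B \in cocirc cuts -> e \in B -> ends e = [set x; y] ->
  exists Y, [/\ Y \subset [set z | connect (adj setT) x z], x \in Y & cut Y = B].
Proof.
move=> cB eB exy; set C := [set z | _].
have cC : component C by apply/existsP; exists x.
have xC : x \in C by rewrite inE connect0.
have yC : y \in C by rewrite -(component_ends cC exy).
have [_ /cutsP[X eX] minB] := cocircP _ _ cB.
have cXC : cut (X :&: C) = B.
  apply: minB; first exact: mem_cuts.
    apply/set0Pn; exists e.
    by rewrite (mem_cut _ exy) !in_setI xC yC !andbT -(mem_cut _ exy) -eX.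
  apply/subsetP=> f /cutP[u [v [fuv /setIP[uX uC] vXC]]].
  rewrite eX; apply/cutP; exists u, v; split=> //; apply: contra vXC => vX.
  by rewrite in_setI vX -(component_ends cC fuv).
have [xX|xX] := boolP (x \in X).
  by exists (X :&: C); rewrite subsetIr in_setI xX xC.
exists (symd C (X :&: C)); rewrite cut_symd (cut_component cC) sym0d.
split=> //; first by rewrite (subset_trans (symd_subU _ _)) // subUset subsetIr subxx.
by rewrite inE in_setI xC (negbTE xX).
Qed.

(** The remaining set cuts exactly the sum of the two bonds. All three cuts being bonds, the parts
    are connected, and minimality makes every two of them adjacent. *)
Lemma tri_of_disjoint C Y1 Y2 : component C -> Y1 \subset C -> Y2 \subset C ->
    [disjoint Y1 & Y2] -> cut Y1 \in cocirc cuts -> cut Y2 \in cocirc cuts ->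
    symd (cut Y1) (cut Y2) \in cocirc cuts ->
  tri C Y1 Y2 (C :\: (Y1 :|: Y2)).
Proof.
move=> cC s1 s2 d c1 c2 c3; set Y3 := C :\: _.
have e3 : Y3 = symd C (symd Y1 Y2).
  apply/setP=> z; rewrite !inE; have [z1|z1] := boolP (z \in Y1).
    by rewrite (subsetP s1 _ z1) (disjointFr d z1).
  by have [z2|z2] := boolP (z \in Y2); rewrite ?(subsetP s2 _ z2) //= addbF.
have cut3 : cut Y3 = symd (cut Y1) (cut Y2).
  by rewrite e3 !cut_symd (cut_component cC) sym0d.
have d13 : [disjoint Y1 & Y3].
  by rewrite -setI_eq0; apply/eqP/setP=> z; rewrite !inE; case: (z \in Y1).
have d23 : [disjoint Y2 & Y3].
  by rewrite -setI_eq0; apply/eqP/setP=> z; rewrite !inE; case: (z \in Y2);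
    rewrite ?orbT.
have n12 : cut Y1 != cut Y2 by rewrite -symd_eq0 (cocirc_neq0 c3).
split=> //.
- by rewrite /Y3 setDE setUIr setUCr setIT; apply/setUidPr; rewrite subUset s1.
- by split; apply: (bond_induced_connected cC); rewrite ?cut3 // subsetDl.
rewrite !joined_cut // cut3; split.
(* Disjoint bonds would place [cut Y1] inside the third bond, forcing equality and an empty
   [cut Y2]. *)
- apply: contraNneq (cocirc_neq0 c1) => cap; apply/eqP.
  have sub : cut Y1 \subset symd (cut Y1) (cut Y2).
    apply/subsetP=> e e1; rewrite inE e1; apply/negP=> e2.
    by have := in_set0 e; rewrite -cap in_setI e1 e2.
  have /eqP := cocirc_sub_eq c1 c3 sub.
  rewrite -symd_eq0 symdA symdd sym0d => e2.
  by rewrite (negbTE (cocirc_neq0 c2)) in e2.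
- have /subsetPn[e e1 e2] : ~~ (cut Y1 \subset cut Y2).
    by apply: contra n12 => s; rewrite (cocirc_sub_eq c1 c2 s).
  by apply/set0Pn; exists e; rewrite in_setI e1 in_set e1 (negbTE e2).
have /subsetPn[e e2 e1] : ~~ (cut Y2 \subset cut Y1).
  by apply: contra n12 => s; rewrite (cocirc_sub_eq c2 c1 s).
by apply/set0Pn; exists e; rewrite in_setI e2 in_set (negbTE e1) e2.
Qed.

(* If [e] joins [x] to [y], choose sides [Y1] of [B1] containing [x] and [Y2]
   of [B2] containing [y]. The cuts of [Y1 :&: Y2] and of the complement of
   [Y1 :|: Y2] both avoid [e], so each is empty or the third bond; hence one
   of these two sets is empty, and the other is the third part. *)
Lemma modular_tri B1 B2 : modular cuts B1 B2 -> symd B1 B2 \in cocirc cuts ->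
  exists C X1 X2 X3, [/\ tri C X1 X2 X3, cut X1 = B1 & cut X2 = B2].
Proof.
move=> m c3; have [c1 c2 _] := and3P m; have n12 := modular_neq cuts0 m.
have [e e1 e2] : exists2 e, e \in B1 & e \in B2.
  have [cap|[e /setIP[]]] := set_0Vmem (B1 :&: B2); last by exists e.
  have sub : B1 \subset symd B1 B2.
    apply/subsetP=> e e1; rewrite inE e1; apply/negP=> e2.
    by have := in_set0 e; rewrite -cap in_setI e1 e2.
  have /eqP := cocirc_sub_eq c1 c3 sub.
  by rewrite -symd_eq0 symdA symdd sym0d (negbTE (cocirc_neq0 c2)).
have [x [y exy]] := endsP e.
have [Y1 [s1 x1 cY1]] := bond_side c1 e1 exy.
have [Y2' [s2' x2' cY2']] := bond_side c2 e2 exy.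
set C := [set z | connect _ _ z] in s1 s2'.
have cC : component C by apply/existsP; exists x.
have compl Y : Y \subset C -> symd C Y = C :\: Y.
  move=> s; apply/setP=> z; rewrite !inE; have [zY|] := boolP (z \in Y).
    by have := subsetP s z zY; rewrite inE => ->.
  by rewrite addbF.
have cutD Y : Y \subset C -> cut (C :\: Y) = cut Y.
  by move=> s; rewrite -compl // cut_symd (cut_component cC) sym0d.
have y1 : y \notin Y1 by move: e1; rewrite -cY1 (mem_cut _ exy) x1; case: (y \in Y1).
have y2' : y \notin Y2' by move: e2; rewrite -cY2' (mem_cut _ exy) x2'; case: (y \in Y2').
pose Y2 := C :\: Y2'; have s2 : Y2 \subset C by apply: subsetDl.
have cY2 : cut Y2 = B2 by rewrite cutD.
have x2 : x \notin Y2 by rewrite in_setD x2'.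
have avo Z : Z \subset C -> (x \in Z) = (y \in Z) ->
    [disjoint cut Z & ~: (cut Y1 :|: cut Y2)] -> cut Z = set0 \/ cut Z = symd B1 B2.
  move=> sZ xyZ dZ; have : cut Z \in avoiding cuts (~: (B1 :|: B2)).
    by rewrite in_avoiding mem_cuts -cY1 -cY2.
  have eZ : e \notin cut Z by rewrite (mem_cut _ exy) xyZ addbb.
  rewrite (modular_avoiding cuts0 cutsD m) !in_setU !in_set1 -!orbA.
  case/or4P=> /eqP eq; [by left | | | by right]; by rewrite eq ?e1 ?e2 in eZ.
have yC : y \in C by rewrite inE connect1 //; apply/exists_inP; exists e; rewrite ?exy ?inE.
have y2 : y \in Y2 by rewrite in_setD y2' yC.
pose I := Y1 :&: Y2; pose O := C :\: (Y1 :|: Y2).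
have sI : I \subset C by rewrite subIset ?s1.
have sO : O \subset C by apply: subsetDl.
have cI : cut I = set0 \/ cut I = symd B1 B2.
  apply: avo => //; first by rewrite !in_setI x1 (negbTE x2) (negbTE y1).
  apply/disjoint_cutP=> u v; case/exists_inP=> f; rewrite in_setC in_setU negb_or.
  move=> /andP[f1 f2] /eqP fuv; move: f1 f2; rewrite !(mem_cut _ fuv) !in_setI.
  by do 4 case: (_ \in _).
have cO : cut O = set0 \/ cut O = symd B1 B2.
  rewrite /O cutD ?subUset ?s1 //; apply: avo; rewrite ?subUset ?s1 //.
    by rewrite !in_setU x1 y2 orbT.
  apply/disjoint_cutP=> u v; case/exists_inP=> f; rewrite in_setC in_setU negb_or.
  move=> /andP[f1 f2] /eqP fuv; move: f1 f2; rewrite !(mem_cut _ fuv) !in_setU.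
  by do 4 case: (_ \in _).
have xC : x \in C by apply: (subsetP s1).
have neqC Z : Z \subset C -> x \notin Z -> cut Z = set0 -> Z = set0.
  by move=> sZ xZ /(cut_eq0 cC sZ)[//|eZ]; rewrite eZ xC in xZ.
have xI : x \notin I by rewrite in_setI (negbTE x2) andbF.
have xO : x \notin O by rewrite in_setD in_setU x1.
have [I0|O0] : I = set0 \/ O = set0.
  case: cI => [/neqC|cI]; first by left; auto.
  case: cO => [/neqC|cO]; first by right; auto.
  (* If both cuts are the third bond, [symd I O] has empty cut and misses [x], so it is empty; [I]
     and [O] being disjoint, [I] is empty. *)
  have IO : symd I O = set0.
    apply: neqC; rewrite ?cut_symd ?cI ?cO ?symdd //.
      by rewrite (subset_trans (symd_subU _ _)) // subUset sI.
    by rewrite inE (negbTE xI) (negbTE xO).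
  left; apply/setP=> z; rewrite in_set0; apply/negP=> zI.
  have : z \in O by have /setP/(_ z) := IO; rewrite inE zI in_set0; case: (z \in O).
  by move: zI; rewrite in_setD in_setU => /setIP[-> _].
- exists C, Y1, Y2, O; split=> //; apply: tri_of_disjoint; rewrite ?cY1 ?cY2 //.
  by rewrite -setI_eq0 -/I I0.
(* With [O] empty the sides cover [C], so their complements are disjoint and serve as parts with
   unchanged cuts. *)
clearbody Y2; exists C, (C :\: Y1), (C :\: Y2), (C :\: (C :\: Y1 :|: C :\: Y2)).
split; rewrite ?cutD //; apply: tri_of_disjoint; rewrite ?subsetDl ?cutD ?cY1 ?cY2 //.
by rewrite -setI_eq0 -setDUr -/O O0.
Qed.

(** Forbidding exactly two members in each triple means that any two force the third, in all orders
    of the parts; [modular_tri] and [tri_modular] pass between triples and modular pairs. *)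
Lemma linear_class_modular_closed (L : {set {set edge G}}) : linear_class L <->
  L \subset cocirc cuts /\ modular_closed cuts L.
Proof.
rewrite /linear_class bonds_cocirc; split=> -[sL lin]; split=> //.
  move=> B1 B2 m l1 l2 c3; have [C [X1 [X2 [X3 [t e1 e2]]]]] := modular_tri m c3.
  have := lin X1 X2 X3 (introT (tripartitionP _ _ _) (ex_intro _ C t)).
  by rewrite (tri_cut3 t) e1 e2 l1 l2; case: (_ \in L).
have closed C X1 X2 X3 : tri C X1 X2 X3 -> cut X1 \in L -> cut X2 \in L -> cut X3 \in L.
  move=> t l1 l2; have c3 := tri_cocirc (tri_swap12 (tri_swap23 t)).
  by move: c3; rewrite (tri_cut3 t); apply: lin (tri_modular t) l1 l2.
move=> X1 X2 X3 /tripartitionP[C t].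
have h3 := closed _ _ _ _ t; have h2 := closed _ _ _ _ (tri_swap23 t).
have h1 := closed _ _ _ _ (tri_swap23 (tri_swap12 t)).
move: h1 h2 h3; case: (cut X1 \in L); case: (cut X2 \in L); case: (cut X3 \in L) => //;
  by [move=> _ _ /(_ isT isT) | move=> _ /(_ isT isT) | move=> /(_ isT isT)].
Qed.

(** The third cut of a tripartition lies in the union of the other two, so a tribond is itself the
    union of a modular pair, and the exclusion of tribonds from dibonds cancels. *)
Lemma tribond_or_dibond F : tribond F || dibond F =
  [exists B1, exists B2, modular cuts B1 B2 && (F == B1 :|: B2)].
Proof.
rewrite /dibond orb_andr orbN andbT.
have -> : [exists B1, exists B2, modular_pair B1 B2 && (F == B1 :|: B2)] =
    [exists B1, exists B2, modular cuts B1 B2 && (F == B1 :|: B2)].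
  by apply: eq_existsb => B1; apply: eq_existsb => B2; rewrite modular_pair_modular.
apply/orb_idl; case/existsP=> X1 /existsP[X2 /existsP[X3 /andP[/tripartitionP[C t] /eqP->]]].
apply/existsP; exists (cut X1); apply/existsP; exists (cut X2).
rewrite (tri_modular t); apply/eqP/setUidPl; rewrite (tri_cut3 t).
exact: symd_subU.
Qed.

Lemma cocircuits_ext_cuts (L : {set {set edge G}}) : L \subset cocirc cuts ->
  cocircuits (ext cuts L) = extension_cocircuits L.
Proof.
move=> sL; apply/setP=> D; rewrite !in_setU bonds_cocirc.
have inj : injective (fun A : {set edge G} => Some @: A) := imset_inj Some_inj.
have [nD|nD] := boolP (None \in D).
  rewrite -(NoneU_Some_old nD) (cocircuits_None cuts0 cutsD).
  have noSome (P : {set {set edge G}}) (A : {set edge G}) :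
      (None |: Some @: A \in [set Some @: (B : {set edge G}) | B in P]) = false.
    apply/negP=> /imsetP[B _ /setP/(_ None)].
    by rewrite setU11 (negbTE (None_notin_Some _)).
  rewrite !noSome orbF /=; apply/idP/imsetP => [h | [B h e]]; first by exists (old D).
  by have := congr1 (@old _) e; rewrite !old_NoneU !old_Some => ->.
rewrite -(Some_old nD) (cocircuits_Some cuts0 cutsD sL) !(mem_imset _ _ inj).
rewrite [_ \in [set None |: _ | _ in _]](_ : _ = false) ?orbF; last first.
  apply/negP=> /imsetP[B _ /setP/(_ None)].
  by rewrite setU11 (negbTE (None_notin_Some _)).
by rewrite [in RHS]in_set tribond_or_dibond.
Qed.

End Cuts.

Theorem theorem3p1 (G : multigraph) :
  (forall L : {set {set edge G}},
     linear_class L -> ~ trivial_class L ->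
     exists N : {set {set option (edge G)}},
       [/\ is_matroid N, ~~ loop N None, ~~ coloop N None
         & cocircuits N = extension_cocircuits L])
  /\
  (forall N : {set {set option (edge G)}},
     single_element_extension (cycle_matroid G) N ->
     ~~ loop N None -> ~~ coloop N None ->
     exists L : {set {set edge G}},
       [/\ linear_class L, ~ trivial_class L
         & cocircuits N = extension_cocircuits L]).
Proof.
have [W0 WD] := (cuts0 G, @cutsD G); rewrite /trivial_class bonds_cocirc.
split=> [L /linear_class_modular_closed[sL mL] nL | N [matN restrN] nl ncl].
  have [B cB lB] : exists2 B, B \in cocirc (cuts G) & B \notin L.
    by apply/subsetPn/negP=> s; apply: nL; apply/eqP; rewrite eqEsubset sL.
  exists (ext (cuts G) L); split.
  - exact: ext_matroid.
  - exact: ext_not_loop cB lB.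
  - exact: ext_not_coloop.
  exact: cocircuits_ext_cuts.
rewrite cycle_matroid_indep in restrN.
exists (unextended (cuts G) N); split.
- apply/linear_class_modular_closed; split; first exact: unextended_sub.
  exact: unextended_modular_closed.
- have [B cB uB] := unextended_nontrivial W0 WD matN restrN ncl nl.
  by move=> e; rewrite e cB in uB.
rewrite {1}(extension_is_ext W0 WD matN restrN ncl).
exact/cocircuits_ext_cuts/unextended_sub.
Qed.
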